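(* The map $c\mapsto \Phi_c$ is an isomorphism of $\mathbb Q$-vector spaces from the space $\mathcal J^*$ of consistent maps onto the algebraic dual $\mathcal S^*$ of $\mathcal S$ (the space of all $\mathbb Q$-linear maps $\mathcal S\to\mathbb Q$).
   Context: Let $\overline{\mathbb Q}$ be an algebraic closure of $\mathbb Q$, $A$ the ring of algebraic integers in $\overline{\mathbb Q}$, and $\mathcal S=\overline{\mathbb Q}^\times/A^\times$, regarded as a $\mathbb Q$-vector space with addition $(\alpha,\beta)\mapsto\alpha\beta$ and scalar multiplication $(r,\alpha)\mapsto\alpha^r$. For a number field $K$ and a non-Archimedean place $v$ of $K$, let $p_v$ be the rational prime below $v$, $K_v$ the completion, and $\|\cdot\|_v$ the unique extension to $K_v$ of the usual $p_v$-adic absolute value on $\mathbb Q_{p_v}$. Let $\mathcal H_K$ be the image of $K^\times$ in $\mathcal S$ and $\mathcal S_K=\{\alpha\in\mathcal S:\alpha^n\in\mathcal H_K\text{ for some }n\in\mathbb N\}$; for $\alpha\in\mathcal S_K$ set $\|\alpha\|_v=\|\alpha^n\|_v^{1/n}$ with $n\ge1$ such that $\alpha^n\in\mathcal H_K$ (well defined). Let $\mathcal J=\{(K,v): K\text{ a number field}, v \text{ a non-Archimedean place of }K\}$. A map $c:\mathcal J\to\mathbb Q$ is consistent if $c(K,v)=\sum_{w\mid v}c(L,w)$ for all number fields $K$, all finite extensions $L/K$, and all non-Archimedean places $v$ of $K$, the sum over places $w$ of $L$ dividing $v$. The consistent maps form a $\mathbb Q$-vector space $\mathcal J^*$ under pointwise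 operations. For $c\in\mathcal J^*$ define $\Phi_c:\mathcal S\to\mathbb Q$ by $\Phi_c(\alpha)=\sum_{v}\frac{c(K,v)}{\log p_v}\log\|\alpha\|_v$, the sum over non-Archimedean places $v$ of any number field $K$ with $\alpha\in\mathcal S_K$ (this is independent of $K$ and $\mathbb Q$-linear). *)

(* Defs.v *)
From HB Require Import structures.
From mathcomp Require Import all_boot all_order all_algebra all_field.
From mathcomp Require Import all_classical.
From mathcomp Require Import reals Rstruct exp.
Set Implicit Arguments. Unset Strict Implicit. Unset Printing Implicit Defensive.
Import Order.TTheory GRing.Theory Num.Theory.
Local Open Scope ring_scope.
Local Open Scope classical_set_scope.

Notation RR := Rdefinitions.R.

Definition unitA (x : algC) : Prop :=
  x != 0 /\ x \in Aint /\ x^-1 \in Aint.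

Definition is_number_field (K : algC -> Prop) : Prop :=
  [/\ K 0 /\ K 1,
      (forall x y, K x -> K y -> K (x - y)),
      (forall x y, K x -> K y -> K (x * y)),
      (forall x, K x -> K x^-1) &
      (exists (n : nat) (b : 'I_n -> algC),
        forall x, K x -> exists a : 'I_n -> rat, x = \sum_(i < n) ratr (a i) * b i)].

Definition numfield := {K : algC -> Prop | is_number_field K}.
Definition nfset (K : numfield) : algC -> Prop := proj1_sig K.

Definition vp (p : nat) (q : rat) : int :=
  (logn p `|numq q|%N)%:Z - (logn p (`|denq q|%N))%:Z.
Definition padic_abs (p : nat) (q : rat) : RR :=
  if q == 0 then 0 else (p%:R : RR) ^ (- vp p q).

(* A non-Archimedean place v of K, with the normalisation of the paper, is
   identified with the absolute value ||.||_v restricted to K: an ultrametric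
   absolute value on K whose restriction to Q is the usual p-adic absolute
   value |.|_p (p = p_v).  It is stored as a pair (p_v, ||.||_v), the function
   being set to 0 outside K so that it is uniquely determined. *)
Definition is_place (K : algC -> Prop) (p : nat) (v : algC -> RR) : Prop :=
  [/\ prime p /\ (forall x, ~ K x -> v x = 0),
      (forall x, K x -> 0 <= v x /\ (v x = 0 <-> x = 0)),
      (forall x y, K x -> K y -> v (x * y) = v x * v y),
      (forall x y, K x -> K y -> v (x + y) <= Num.max (v x) (v y)) &
      (forall q : rat, v (ratr q) = padic_abs p q)].

Definition place (K : numfield) :=
  {pv : nat * (algC -> RR) | is_place (nfset K) pv.1 pv.2}.

HB.instance Definition _ (K : numfield) := gen_eqMixin (place K).
HB.instance Definition _ (K : numfield) := gen_choiceMixin (place K).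


Definition pl_p {K : numfield} (v : place K) : nat := (proj1_sig v).1.
Definition pl_abs {K : numfield} (v : place K) : algC -> RR := (proj1_sig v).2.

Definition divides {K L : numfield} (w : place L) (v : place K) : Prop :=
  forall x, nfset K x -> pl_abs w x = pl_abs v x.

Definition Jmap := forall K : numfield, place K -> rat.

Definition consistent (c : Jmap) : Prop :=
  forall (K L : numfield), (forall x, nfset K x -> nfset L x) ->
  forall v : place K,
    c K v = \sum_(w \in [set w : place L | divides w v]) c L w.

(* alpha in S_K via the data (n, k): alpha^n = u k with u in A^x, k in K^x;
   then ||alpha||_v = ||k||_v^(1/n). *)
Definition SK_rep (K : numfield) (alpha : algC) (n : nat) (k : algC) : Prop :=
  [/\ (0 < n)%N, nfset K k, k != 0 & unitA (alpha ^+ n / k)].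

Definition Phi_sum (c : Jmap) (K : numfield) (n : nat) (k : algC) : RR :=
  \sum_(v \in [set: place K])
     (ratr (c K v) / ln ((pl_p v)%:R : RR)) * (ln (pl_abs v k) / n%:R).

(* Phi_c(alpha) = sum_v c(K,v)/log p_v * log ||alpha||_v for any number field
   K with alpha in S_K (the value is independent of the choices). *)
Definition Phi (c : Jmap) (alpha : algC) : RR :=
  xget 0 [set x | exists (K : numfield) (n : nat) (k : algC),
                    SK_rep K alpha n k /\ x = Phi_sum c K n k].

(* Q-linear maps S -> Q, S = Qbar^x / A^x, represented on representatives
   alpha != 0: f(alpha beta) = f alpha + f beta, and f(alpha^(m/n)) =
   (m/n) f(alpha), where beta represents alpha^(m/n) iff beta^n / alpha^m
   is a unit of A. *)
Definition S_linear (f : algC -> rat) : Prop :=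
  (forall a b, a != 0 -> b != 0 -> f (a * b) = f a + f b) /\
  (forall a b (m : int) (n : nat), a != 0 -> b != 0 -> (0 < n)%N ->
     unitA (b ^+ n / a ^ m) -> f b = (m%:~R / n%:R) * f a).

(* Main.v *)
Require Import Defs.
From HB Require Import structures.
From mathcomp Require Import all_boot all_order all_algebra all_field.
From mathcomp Require Import all_classical.
From mathcomp Require Import reals Rstruct sequences exp.
From mathcomp Require Import ring lra.
Set Implicit Arguments. Unset Strict Implicit. Unset Printing Implicit Defensive.
Import Order.TTheory GRing.Theory Num.Theory.
Local Open Scope ring_scope.
Local Open Scope classical_set_scope.

(** Every place v of K takes values in p_v^Q, because two terms of a polynomial
    relation over Q must have the same absolute value; so v is given by a rational
    valuation, and Phi_c(k) = - sum_v c(K,v) v(k) for k in K^x.  Consistency makes this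
    independent of K, and an element of K^x is a unit of A iff all its valuations
    vanish: if x is not integral, a subring of Qbar maximal among those containing 1/x
    and not x is a valuation ring, which yields a place with |x| > 1.

    The isomorphism then reduces to the existence, for each v, of an isolating element
    a_v of K^x with v(a_v) > 0 and w(a_v) = 0 for all w <> v, i.e. to the class of the
    prime at v being torsion.  Weak approximation gives an integral x in K with |x|_v < 1
    and |x|_w = 1 at the other places above p_v, and Hurwitz' pigeonhole argument,
    applied to the ideals {y in Z[x] : |y|_v <= rho^m}, shows that two of them are
    proportional; the ratio isolates v.  Evaluating Phi_c at a_v recovers c(K,v), and
    a linear form f on S equals Phi_c for c(K,v) = - f(a_v) / v(a_v). *)

(** The obstacle is the class group: the prime at v need not be principal. As S is a Q-vector space,
    a principal power is enough, so one coincidence among ideals attached to its powers suffices.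
    The order Z[x] may be smaller than the ring of integers of K, and Q(x) smaller than K. This is
    harmless: with rho = max(|x|_v, |p_v|_v) the m-th ideal contains x^m and p_v^m, and at every w
    <> v one of x, p_v has absolute value 1, namely x above p_v and p_v elsewhere. The factor
    between two proportional ideals therefore has absolute value 1 at every w <> v. Hurwitz'
    argument replaces Dedekind theory and geometry of numbers by integer matrices, a determinant
    used as norm, and pigeonholes. *)

Lemma logn_part_coprime p n : prime p -> (0 < n)%N ->
  exists2 m, coprime p m & n = (p ^ logn p n * m)%N.
Proof.
move=> p_pr n_gt0; exists (n`_p^')%N; last by rewrite -p_part partnC.
by rewrite prime_coprime // -p'natE // part_pnat.
Qed.

(** * Valuation rings *)

Section ValuationRing.
Variables (K : divringClosed algC) (V : subringClosed algC).
Hypothesis VK : forall x, x \in K -> x \in V \/ x^-1 \in V.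

(** The unit group of V. The section serves twice: with V = {|x|_v <= 1} in a number field it yields
    the rationality of the values of v, and with V a valuation ring of [algC] it helps to build a
    place. *)
Definition vunit (x : algC) := [&& x != 0, x \in V & x^-1 \in V].

Lemma vunit1 : vunit 1.
Proof. by rewrite /vunit oner_neq0 invr1 rpred1. Qed.

Lemma vunitM x y : vunit x -> vunit y -> vunit (x * y).
Proof.
case/and3P=> x0 xV xiV /and3P[y0 yV yiV].
by rewrite /vunit mulf_neq0 // invfM !rpredM.
Qed.

Lemma vunitV x : vunit x^-1 = vunit x.
Proof. by rewrite /vunit invr_eq0 invrK (andbC (x \in V)). Qed.

Lemma vunitX x n : vunit x -> vunit (x ^+ n).
Proof.
by move=> ux; elim: n => [|n IH]; rewrite ?expr0 ?vunit1 // exprS vunitM.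
Qed.

(** Dividing f(x) = 0 by x^n, where f has degree n + 1, writes x as a V-combination of nonnegative
    powers of 1/x. *)
Lemma valring_integral (f : {poly algC}) x :
  f \is monic -> f \is a polyOver V -> root f x -> x^-1 \in V -> x \in V.
Proof.
move=> f_monic fV /rootP fx0 yV.
have [->|x0] := eqVneq x 0; first exact: rpred0.
have [n szf] : exists n, size f = n.+2.
  have := root_size_gt1 (monic_neq0 f_monic) (introT rootP fx0).
  by case: (size f) => [|[|n]] // _; exists n.
have : \sum_(i < n.+2) f`_i * x ^+ i = 0 by rewrite -szf -horner_coef.
rewrite big_ord_recr /=.
have -> : f`_n.+1 = 1 by rewrite -(eqP f_monic) lead_coefE szf.
rewrite mul1r addrC => /eqP; rewrite addr_eq0 => /eqP xn.
have -> : x = x ^+ n.+1 * x^-1 ^+ n.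
  by rewrite exprS -mulrA -exprMn divff // expr1n mulr1.
rewrite xn mulNr rpredN mulr_suml rpred_sum // => i _.
rewrite -mulrA rpredM ?(polyOverP fV) //.
have -> : x^-1 ^+ n = x^-1 ^+ i * x^-1 ^+ (n - i) by rewrite -exprD subnKC // -ltnS.
by rewrite mulrA -exprMn divff // expr1n mul1r rpredX.
Qed.

Lemma valring_Aint x : x \in K -> x \in Aint -> x \in V.
Proof.
move=> xK xA; case: (VK xK) => // xiV.
apply: valring_integral (minCpoly_monic x) _ (root_minCpoly x) xiV.
by apply: polyOverS xA => z /intrP[m ->]; exact: rpred_int.
Qed.

(** Divisibility in V is total, so y/x may be assumed to be in V; if x + y were a unit, then x^-1 =
    (x + y)^-1 (1 + y/x) would be in V. *)
Lemma vnonunitD x y : x \in K -> y \in K -> x \in V -> y \in V ->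
  ~~ vunit x -> ~~ vunit y -> ~~ vunit (x + y).
Proof.
have [->|x0] := eqVneq x 0; first by rewrite add0r.
have [->|y0] := eqVneq y 0; first by rewrite addr0.
wlog yx : x y x0 y0 / y / x \in V => [IH|] xK yK xV yV nx ny.
  have [yx|] : (y / x \in V) \/ (y / x)^-1 \in V by apply: VK; exact: rpred_div.
    exact: IH.
  by rewrite invf_div => xy; rewrite addrC; apply: IH.
apply: contra nx => /and3P[xy0 _ xyV]; rewrite /vunit x0 xV /=.
suff -> : x^-1 = (x + y)^-1 * (1 + y / x) by rewrite rpredM // rpredD ?rpred1.
by field; apply/andP.
Qed.

Lemma vnonunit_sum (I : eqType) (s : seq I) (F : I -> algC) :
  (forall i, i \in s -> [/\ F i \in K, F i \in V & ~~ vunit (F i)]) ->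
  ~~ vunit (\sum_(i <- s) F i).
Proof.
move=> H.
suff : [/\ \sum_(i <- s) F i \in K, \sum_(i <- s) F i \in V
  & ~~ vunit (\sum_(i <- s) F i)] by case.
elim: s H => [|i s IH] H; first by rewrite big_nil !rpred0 /vunit eqxx.
rewrite big_cons.
have [FK FV Fu] := H i (mem_head _ _).
have [|SK SV Su] := IH; first by move=> j js; apply: H; rewrite inE js orbT.
by rewrite !rpredD // vnonunitD.
Qed.

Lemma valring_max (I : eqType) (s : seq I) (F : I -> algC) : s != [::] ->
  (forall i, i \in s -> F i \in K /\ F i != 0) ->
  exists2 i, i \in s & forall j, j \in s -> F j / F i \in V.
Proof.
elim: s => // i [|j s] IH _ H.
  exists i; first exact: mem_head.
  move=> j; rewrite inE => /eqP->; rewrite divff ?rpred1 //.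
  by case: (H i (mem_head _ _)).
have [//||k ks Hk] := IH; first by move=> l ls; apply: H; rewrite inE ls orbT.
have [iK i0] := H i (mem_head _ _).
have [kK k0] : F k \in K /\ F k != 0 by apply: H; rewrite inE ks orbT.
have [ik|] : (F i / F k \in V) \/ (F i / F k)^-1 \in V.
- by apply: VK; exact: rpred_div.
- exists k; first by rewrite inE ks orbT.
  by move=> l; rewrite inE => /predU1P[->|/Hk].
rewrite invf_div => ki; exists i; first exact: mem_head.
move=> l; rewrite inE => /predU1P[->|/Hk lk]; first by rewrite divff ?rpred1.
have -> : F l / F i = (F l / F k) * (F k / F i) by rewrite mulrA divfK.
exact: rpredM.
Qed.

Variable p : nat.
Hypothesis p_pr : prime p.
Hypothesis pV : forall n : nat, coprime p n -> (n%:R : algC)^-1 \in V.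

Let p0 : (p%:R : algC) != 0.
Proof. by rewrite pnatr_eq0 -lt0n prime_gt0. Qed.

Lemma vunit_nat n : coprime p n -> vunit n%:R.
Proof.
move=> pn; rewrite /vunit rpred_nat pV // pnatr_eq0 !andbT.
by apply: contraTneq pn => ->; rewrite /coprime gcdn0; case: p p_pr => [|[]].
Qed.

Lemma vunit_rat (q : rat) : q != 0 -> vunit (ratr q * p%:R ^ (- vp p q)).
Proof.
move=> q0.
have [a pa Ea] : exists2 a, coprime p a & `|numq q|%N = (p ^ logn p `|numq q| * a)%N.
  by apply: logn_part_coprime; rewrite // absz_gt0 numq_eq0.
have [b pb Eb] : exists2 b, coprime p b & `|denq q|%N = (p ^ logn p `|denq q| * b)%N.
  by apply: logn_part_coprime; rewrite // absz_gt0 denq_neq0.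
have -> : ratr q * p%:R ^ (- vp p q) = (-1) ^+ (numq q < 0)%R * (a%:R / b%:R) :> algC.
  rewrite /ratr [in LHS](intEsign (numq q)) rmorphM rmorphXn rmorphN1 -!mulrA.
  congr (_ * _); rewrite -[in LHS](gtz0_abs (denq_gt0 q)) /vp opprB expfzDr //.
  rewrite -exprnP -exprnN /= -!pmulrn {1}Ea {1}Eb !natrM !natrX.
  have : (b%:R : algC) != 0 by case/and3P: (vunit_nat pb).
  have pe n : (p%:R : algC) ^+ n != 0 by rewrite expf_neq0.
  move: (pe (logn p `|numq q|)) (pe (logn p `|denq q|)) => P1 P2 b0.
  by field; rewrite ?P1 ?P2 ?b0.
rewrite vunitM ?vunitX ?vunitM ?vunitV ?vunit_nat //.
by rewrite /vunit oppr_eq0 oner_eq0 invrN invr1 rpredN rpred1.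
Qed.

Lemma valring_rational x : x \in K -> x != 0 ->
  exists d r, (0 < d)%N /\ vunit (x ^+ d * p%:R ^ (- r)).
Proof.
move=> xK x0; have [f [Df f_monic] fP] := minCpolyP x.
pose t i := ratr f`_i * x ^+ i : algC.
pose s := [seq i <- iota 0 (size f) | f`_i != 0].
have tP i : i \in s -> t i \in K /\ t i != 0.
  rewrite mem_filter => /andP[fi0 _]; split.
    by rewrite rpredM ?rpredX // rpred_rat.
  by rewrite mulf_neq0 ?expf_neq0 // fmorph_eq0.
have f0 := monic_neq0 f_monic.
have s0 : s != [::].
  apply/eqP => s0; have : (size f).-1 \in s.
    rewrite mem_filter -lead_coefE lead_coef_eq0 f0 mem_iota add0n /=.
    by rewrite ltn_predL size_poly_gt0.
  by rewrite s0.
have [i0 i0s Hi0] := valring_max s0 tP.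
have sum0 : \sum_(i <- s) t i = 0.
  have := root_minCpoly x; rewrite Df => /rootP.
  rewrite horner_coef size_map_poly => sum0; rewrite big_filter big_mkcond /=.
  rewrite -[RHS]sum0 -(big_mkord xpredT (fun i => (map_poly ratr f)`_i * x ^+ i)).
  rewrite /index_iota subn0; apply: eq_bigr => i _; rewrite coef_map /t.
  by case: eqVneq => //= ->; rewrite rmorph0 mul0r.
have us : uniq s by rewrite filter_uniq ?iota_uniq.
have [_ ti0] := tP _ i0s.
(* Otherwise the other terms, divided by [t i0], would be nonunits whose sum is the unit -1. *)
have [i [is_ ii0 ui]] : exists i, [/\ i \in s, i != i0 & vunit (t i / t i0)].
  apply: contrapT => nex.
  have : ~~ vunit (\sum_(i <- [seq i <- s | i != i0]) t i / t i0).
    apply: vnonunit_sum => i; rewrite mem_filter => /andP[ii0 is_].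
    split; last by apply/negP => ui; apply: nex; exists i.
      by rewrite rpred_div //; [case: (tP i is_)|case: (tP _ i0s)].
    exact: Hi0.
  rewrite big_filter -mulr_suml.
  move/eqP: sum0; rewrite (bigD1_seq i0) //= addrC addr_eq0 => /eqP->.
  by rewrite mulNr divff // /vunit oppr_eq0 oner_eq0 invrN invr1 rpredN rpred1.
have fne j : j \in s -> f`_j != 0 by rewrite mem_filter => /andP[].
pose q := f`_i / f`_i0.
have q0 : q != 0 by rewrite mulf_neq0 ?invr_eq0 ?fne.
have uq := vunit_rat q0.
have tt : t i / t i0 = ratr q * x ^ (i%:Z - i0%:Z).
  rewrite /t /q fmorph_div /= expfzDr // -exprnP -exprnN invfM; ring.
have {}ui : vunit (x ^ (i%:Z - i0%:Z) * p%:R ^ (vp p q)).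
  have : vunit ((t i / t i0) * (ratr q * p%:R ^ (- vp p q))^-1).
    by rewrite vunitM ?vunitV.
  by rewrite tt invfM invr_expz opprK mulrACA divff ?mul1r // fmorph_eq0.
case: (ltngtP i0 i) => [lt|lt|E]; last by rewrite E eqxx in ii0.
- exists (i - i0)%N, (- vp p q); rewrite subn_gt0 opprK; split=> //.
  by rewrite exprnP -subzn // ltnW.
- exists (i0 - i)%N, (vp p q); rewrite subn_gt0; split=> //.
  rewrite exprnP -subzn 1?ltnW // -vunitV invfM !invr_expz opprK opprB.
  exact: ui.
Qed.

End ValuationRing.

(** * Existence of valuation rings *)

Definition adjoin (V : {pred algC}) (z : algC) : {pred algC} :=
  fun y => `[< exists2 f : {poly algC}, f \is a polyOver V & y = f.[z] >].

Lemma adjoinP (V : {pred algC}) z y :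
  reflect (exists2 f : {poly algC}, f \is a polyOver V & y = f.[z]) (y \in adjoin V z).
Proof. exact: asboolP. Qed.

Lemma adjoin_subring (V : subringClosed algC) z : subring_closed (adjoin V z).
Proof.
split=> [|x y|x y].
- by apply/adjoinP; exists 1; rewrite ?rpred1 ?hornerC.
- move=> /adjoinP[f fV ->] /adjoinP[g gV ->]; apply/adjoinP.
  by exists (f - g); rewrite ?rpredB // hornerD hornerN.
- move=> /adjoinP[f fV ->] /adjoinP[g gV ->]; apply/adjoinP.
  by exists (f * g); rewrite ?rpredM // hornerM.
Qed.

Lemma sub_adjoin (V : subringClosed algC) z y : y \in V -> y \in adjoin V z.
Proof. by move=> yV; apply/adjoinP; exists y%:P; rewrite ?polyOverC ?hornerC. Qed.

Lemma mem_adjoin (V : subringClosed algC) z : z \in adjoin V z.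
Proof. by apply/adjoinP; exists 'X; rewrite ?polyOverX ?hornerX. Qed.

Definition set_pred (A : set algC) : {pred algC} := fun x => `[< A x >].

Definition mk_subring (V : {pred algC}) (H : subring_closed V) : subringClosed algC :=
  HB.pack V (GRing.isSubringClosed.Build _ V H).

Lemma Aint_adjoin_inv (x : algC) : x != 0 -> x \in adjoin Num.int x^-1 -> x \in Aint.
Proof.
move=> x0 /adjoinP[f fZ Ex].
pose n := size f.
(* Multiplying x = f(1/x) by x^n gives x^(n+1) as the sum of the f_j x^(n-j) for j < n; all
   exponents on the right lie between 1 and n, so the relation is monic. *)
pose g : {poly algC} := 'X^(n.+1) - (\poly_(i < n) f`_(n - i.+1)) * 'X.
have szg : (size ((\poly_(i < n) f`_(n - i.+1)) * 'X)%R < n.+2)%N.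
  by rewrite (leq_ltn_trans (size_polyMleq _ _)) // size_polyX addn2 /= !ltnS size_poly.
apply: (@root_monic_Aint g).
- rewrite /root /g hornerD hornerN hornerXn hornerM hornerX horner_poly subr_eq0.
  apply/eqP; rewrite exprS {1}Ex horner_coef !mulr_suml (reindex_inj rev_ord_inj) /=.
  apply: eq_bigr => i _; rewrite -!mulrA; congr (_ * _).
  have -> : x ^+ n = x ^+ (n - i.+1) * x ^+ i.+1 by rewrite -exprD subnK.
  by rewrite exprVn mulKf ?expf_neq0 // exprSr.
- rewrite monicE lead_coefDl ?lead_coefXn // size_polyXn size_polyN.
  exact: szg.
- apply/polyOverP => i; rewrite coefB coefXn coefMX coef_poly.
  apply: rpredB; first exact: rpred_nat.
  case: (i == 0%N); first exact: rpred0.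
  by case: (i.-1 < n)%N; [exact: (polyOverP fZ)|exact: rpred0].
Qed.

Section MaximalSubring.
Variables (V : subringClosed algC) (x : algC).
Hypothesis x0 : x != 0.
Hypothesis yV : x^-1 \in V.
Hypothesis xV : x \notin V.
Hypothesis Vmax : forall z, z \notin V -> x \in adjoin V z.

(** This puts 1/x in the Jacobson radical of V. If s^-1 were outside V, maximality would give x =
    f(s^-1), so x s^k would be in V for k = size f; but s^k = 1 - c/x with c in V, so x - c, and
    then x, would be in V. *)
Lemma maximal_inv b : b \in V -> (1 - x^-1 * b)^-1 \in V.
Proof.
move=> bV; set s := 1 - _; apply: contraT => /Vmax /adjoinP[f fV Ex].
have s0 : s != 0.
  apply: contraNneq xV => /eqP; rewrite subr_eq0 => /eqP E.
  by rewrite -[x]mulr1 E mulrA divff // mul1r.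
have sV : s \in V by rewrite rpredB ?rpred1 ?rpredM.
have sX k : exists2 c, c \in V & s ^+ k = 1 - x^-1 * c.
  elim: k => [|k [c cV E]]; first by exists 0; rewrite ?rpred0 ?mulr0 ?subr0.
  exists (b * (1 - x^-1 * c) + c); first by rewrite rpredD // rpredM // rpredB ?rpred1 // rpredM.
  by rewrite exprS E /s; ring.
have [c cV sc] := sX (size f).
have xs : x * s ^+ size f \in V.
  rewrite {1}Ex horner_coef mulr_suml rpred_sum // => i _.
  rewrite -mulrA rpredM ?(polyOverP fV) // exprVn.
  have -> : s ^+ size f = s ^+ i * s ^+ (size f - i) by rewrite -exprD subnKC // ltnW.
  by rewrite mulKf ?expf_neq0 // rpredX.
move: xs; rewrite sc mulrBr mulr1 mulrA divff // mul1r => xc.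
by case/negP: xV; rewrite -(subrK c x) rpredD.
Qed.

(** Dividing x = g(1/z) by x expresses s = 1 - x^-1 g_0, which is a unit of V, as the sum of the
    x^-1 g_j z^-j for j >= 1. Multiplication by z^(n+1)/s makes z^(n+1) a V-combination of lower
    powers of z, and this replaces the top term of f. *)
Lemma maximal_lower n z (f g : {poly algC}) :
  f \is a polyOver V -> g \is a polyOver V -> z != 0 ->
  (size f <= n.+2)%N -> (size g <= n.+2)%N -> x = f.[z] -> x = g.[z^-1] ->
  exists2 h : {poly algC}, h \is a polyOver V & (size h <= n.+1)%N /\ x = h.[z].
Proof.
move=> fV gV z0 szf szg Ef Eg.
have fV' := polyOverP fV; have gV' := polyOverP gV.
pose s := 1 - x^-1 * g`_0; have sV : s^-1 \in V by exact: maximal_inv.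
have s0 : s != 0.
  apply: contraNneq xV => /eqP; rewrite subr_eq0 => /eqP E.
  by rewrite -[x]mulr1 E mulrA divff // mul1r.
have Es : s = \sum_(j < n.+1) x^-1 * g`_j.+1 * z ^- j.+1.
  rewrite /s -{1}(mulVf x0) {2}Eg (horner_coef_wide _ szg) big_ord_recl /= expr0.
  rewrite mulr1 mulrDr addrC addKr mulr_sumr; apply: eq_bigr => j _.
  by rewrite /bump /= mulrA exprVn.
pose u := \poly_(i < n.+1) (s^-1 * x^-1 * g`_(n.+1 - i)).
have Eu : z ^+ n.+1 = u.[z].
  rewrite horner_poly -[LHS]mul1r -(mulVf s0) {2}Es mulr_sumr mulr_suml.
  rewrite (reindex_inj rev_ord_inj) /=; apply: eq_bigr => j _.
  rewrite subSS (_ : (n - j).+1 = n.+1 - j)%N; last by rewrite subSn // -ltnS.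
  have -> : z ^+ n.+1 = z ^+ j * z ^+ (n.+1 - j) by rewrite -exprD subnKC // ltnW.
  rewrite -!mulrA; do 3 congr (_ * _).
  by rewrite mulrCA mulVf ?mulr1 // expf_neq0.
exists (\poly_(i < n.+1) f`_i + f`_n.+1 *: u).
  rewrite rpredD //; first by apply/polyOver_poly => i _.
  rewrite polyOverZ //; apply/polyOver_poly => i _.
  by rewrite !rpredM.
split.
  rewrite (leq_trans (size_polyD _ _)) // geq_max size_poly /=.
  by rewrite (leq_trans (size_scale_leq _ _)) // size_poly.
rewrite hornerD hornerZ -Eu {1}Ef (horner_coef_wide _ szf) big_ord_recr /=.
by rewrite horner_poly.
Qed.

(** Descent on the total size of two polynomials representing x, one in z and one in 1/z:
    [maximal_lower] shortens the longer one until one of them is constant, which would put x in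
    V. *)
Lemma maximal_valring z : z \in V \/ z^-1 \in V.
Proof.
apply: contrapT => /not_orP[/negP zV /negP ziV].
have z0 : z != 0 by apply: contraNneq zV => ->; exact: rpred0.
pose P z n := exists2 f : {poly algC}, f \is a polyOver V & (size f <= n)%N /\ x = f.[z].
suff H : forall k n m z', (n + m <= k)%N -> z' != 0 -> P z' n -> P z'^-1 m -> False.
  have [f fV Ef] := adjoinP _ _ _ (Vmax zV).
  have [g gV Eg] := adjoinP _ _ _ (Vmax ziV).
  by apply: (H _ (size f) (size g) z (leqnn _)) => //; [exists f|exists g].
have P1 z' : ~ P z' 1%N.
  case=> f fV [sz E]; case/negP: xV.
  by rewrite E (size1_polyC sz) hornerC (polyOverP fV).
elim=> [|k IH] n m z' le z'0 Hn Hm.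
  move: Hn; rewrite leqn0 addn_eq0 in le; case/andP: le => /eqP-> _.
  by case=> f fV [sz E]; apply: (P1 z'); exists f => //; split=> //; exact: leq_trans sz _.
have [mn|nm] := leqP m n.
  case: n Hn le mn => [|[|n]] Hn le mn.
  - by case: Hn => f fV [sz E]; apply: (P1 z'); exists f => //; split=> //; exact: leq_trans sz _.
  - exact: P1 Hn.
  case: Hn Hm => f fV [szf Ef] [g gV [szg Eg]].
  have [h hV [szh Eh]] := maximal_lower fV gV z'0 szf (leq_trans szg mn) Ef Eg.
  by apply: (IH n.+1 m z') => //; [exists h|exists g].
case: m Hm le nm => [|[|m]] Hm le nm.
- by case: Hm => f fV [sz E]; apply: (P1 z'^-1); exists f => //; split=> //; exact: leq_trans sz _.
- exact: P1 Hm.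
case: Hn Hm => f fV [szf Ef] [g gV [szg Eg]].
have zi0 : z'^-1 != 0 by rewrite invr_eq0.
have Ef' : x = f.[z'^-1^-1] by rewrite invrK.
have [h hV [szh Eh]] := maximal_lower gV fV zi0 szg (leq_trans szf (ltnW nm)) Eg Ef'.
apply: (IH n m.+1 z') => //; [|by exists f|by exists h].
by rewrite addnS ltnS in le.
Qed.

End MaximalSubring.

Lemma exists_valring x : x \notin Aint -> exists V : subringClosed algC,
  [/\ x \notin V, x^-1 \in V & forall z, z \in V \/ z^-1 \in V].
Proof.
move=> xA.
have x0 : x != 0 by apply: contraNneq xA => ->.
(* The conditions bear on nonempty sets only, since Zorn's lemma also considers the empty chain,
   whose union is empty. *)
pose P (A : set algC) := A !=set0 ->
  [/\ subring_closed (set_pred A), A x^-1 & ~ A x].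
have [|A [PA Amax]] := @Zorn_bigcup algC P.
  move=> F FP Ftot [y [A FA Ay]].
  have PA B u : F B -> B u -> [/\ subring_closed (set_pred B), B x^-1 & ~ B x].
    by move=> FB Bu; apply: FP => //; exists u.
  split; last first.
  - by case=> B FB Bx; case: (PA B x FB Bx).
  - by exists A => //; case: (PA A y FA Ay).
  have two u w : (\bigcup_(X in F) X) u -> (\bigcup_(X in F) X) w ->
      exists B, [/\ F B, B u & B w].
    case=> B FB Bu [C FC Cw]; case: (Ftot B C FB FC) => BC.
      by exists C; split=> //; exact: BC.
    by exists B; split=> //; exact: BC.
  split=> [|u w /asboolP Hu /asboolP Hw|u w /asboolP Hu /asboolP Hw].
  - apply/asboolP; exists A => //.
    by have [[/asboolP]] := PA A y FA Ay.
  - have [B [FB Bu Bw]] := two u w Hu Hw; have [[_ H _] _ _] := PA B u FB Bu.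
    apply/asboolP; exists B => //.
    by apply/asboolP; apply: H; exact/asboolP.
  - have [B [FB Bu Bw]] := two u w Hu Hw; have [[_ _ H] _ _] := PA B u FB Bu.
    apply/asboolP; exists B => //.
    by apply/asboolP; apply: H; exact/asboolP.
have PB (V : subringClosed algC) : x^-1 \in V -> x \notin V -> P [set` V].
  move=> yV xV _; split=> //; last exact/negP.
  by split=> [|u w|u w]; rewrite /set_pred !unfold_in /= !asboolE ?rpred1 //;
    move=> uV wV; rewrite ?rpredB ?rpredM.
(* The empty set satisfies [P] vacuously; it is not maximal because Z[1/x] satisfies [P] as well, x
   being non-integral. *)
have A0 : A !=set0.
  apply: contrapT => /set0P/negP; rewrite negbK => /eqP A0.
  have intring : subring_closed (Num.int : {pred algC}).
    by split=> [|u w uZ wZ|u w uZ wZ]; [exact: rpred1|exact: rpredB|exact: rpredM].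
  pose V := mk_subring (adjoin_subring (mk_subring intring) x^-1).
  apply: (Amax [set` V]); last first.
    by apply: PB; [exact: mem_adjoin|apply: contra xA; exact: Aint_adjoin_inv].
  rewrite A0; split; first exact: sub0set.
  by move/(_ 1); apply; exact: (rpred1 V).
have [Aring Ay Ax] := PA A0.
pose V := mk_subring Aring; exists V.
have xV : x \notin V by apply/asboolP.
have yV : x^-1 \in V by apply/asboolP.
split=> // z; apply: (maximal_valring x0) => // {}z zV.
apply: contraT => xad.
pose W := mk_subring (adjoin_subring V z).
exfalso; apply: (Amax [set` W]); last first.
  by apply: PB; [exact: (@sub_adjoin V z _ yV)|exact: xad].
split; first by move=> u Au /=; apply: (@sub_adjoin V z u); exact/asboolP.
move=> sub; case/negP: zV; apply/asboolP; apply: sub; exact: (@mem_adjoin V z).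
Qed.

(** * Places of a number field *)

Definition nfpred (K : numfield) : {pred algC} := fun x => `[< nfset K x >].

Lemma nfP (K : numfield) x : reflect (nfset K x) (x \in nfpred K).
Proof. exact: asboolP. Qed.

Lemma nf_divring (K : numfield) : divring_closed (nfpred K).
Proof.
case: (proj2_sig K) => [[_ K1] KB KM KV _]; split.
- exact/nfP.
- by move=> x y /nfP xK /nfP yK; apply/nfP; exact: KB.
- by move=> x y /nfP xK /nfP yK; apply/nfP; apply: KM => //; exact: KV.
Qed.
HB.instance Definition _ K := GRing.isDivringClosed.Build algC (nfpred K) (nf_divring K).

Lemma expRMz (x : RR) (z : int) : expR (x * z%:~R) = expR x ^ z.
Proof.
case: z => n; first by rewrite -pmulrn expRM_natr.
by rewrite NegzE mulrNz mulrN expRN -pmulrn expRM_natr exprnN.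
Qed.

Lemma expR_lnMz (a : RR) (z : int) : 0 < a -> expR (ln a * z%:~R) = a ^ z.
Proof. by move=> a0; rewrite expRMz lnK. Qed.

Lemma vp_nat p n : vp p n%:R = (logn p n)%:Z.
Proof.
rewrite /vp (_ : n%:R = n%:Z%:~R); last by rewrite -pmulrn.
by rewrite numq_int denq_int /= logn1 subr0.
Qed.

Section Place.
Variables (K : numfield) (v : place K).
Local Notation p := (pl_p v).
Local Notation "'absv' x" := (pl_abs v x) (at level 10, x at level 9).

Lemma pl_prime : prime p.
Proof. by case: (proj2_sig v) => -[]. Qed.

Lemma pl_gt1 : 1 < (p%:R : RR).
Proof. by rewrite ltr1n prime_gt1 // pl_prime. Qed.

Lemma pl_gt0 : 0 < (p%:R : RR).
Proof. exact: lt_trans ltr01 pl_gt1. Qed.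

Lemma ln_pl_gt0 : 0 < ln (p%:R : RR).
Proof. exact: ln_gt0 pl_gt1. Qed.

Lemma pabs_ge0 x : 0 <= absv x.
Proof.
case: (proj2_sig v) => [[_ out] H _ _ _].
by case: (pselect (nfset K x)) => [/H[]//|/out E]; rewrite /pl_abs E.
Qed.

Lemma pabs_eq0 x : x \in nfpred K -> (absv x == 0) = (x == 0).
Proof.
case: (proj2_sig v) => [_ H _ _ _] /nfP/H[_ E].
by apply/eqP/eqP => /E.
Qed.

Lemma pabs_gt0 x : x \in nfpred K -> (0 < absv x) = (x != 0).
Proof. by move=> xK; rewrite lt0r pabs_ge0 andbT pabs_eq0. Qed.

Lemma pabs0 : absv 0 = 0.
Proof. by apply/eqP; rewrite pabs_eq0 ?rpred0. Qed.

Lemma pabsM x y : x \in nfpred K -> y \in nfpred K -> absv (x * y) = absv x * absv y.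
Proof. by case: (proj2_sig v) => [_ _ H _ _] /nfP xK /nfP yK; exact: H. Qed.

Lemma pabsD x y : x \in nfpred K -> y \in nfpred K -> absv (x + y) <= Num.max (absv x) (absv y).
Proof. by case: (proj2_sig v) => [_ _ _ H _] /nfP xK /nfP yK; exact: H. Qed.

Lemma pabs_rat (q : rat) : absv (ratr q) = padic_abs p q.
Proof. by case: (proj2_sig v) => [_ _ _ _]; exact. Qed.

Lemma pabs_nat n : (0 < n)%N -> absv n%:R = p%:R ^- logn p n.
Proof.
move=> n0; have := pabs_rat n%:R; rewrite ratr_nat => ->.
by rewrite /padic_abs pnatr_eq0 (gtn_eqF n0) vp_nat exprnN.
Qed.

Lemma pabs1 : absv 1 = 1.
Proof. by have := @pabs_nat 1 isT; rewrite logn1 expr0 invr1. Qed.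

Lemma pabs_p : absv p%:R = p%:R^-1.
Proof. by rewrite pabs_nat ?prime_gt0 ?logn_prime ?eqxx ?expr1 ?pl_prime. Qed.

Lemma pabs_coprime n : coprime p n -> absv n%:R = 1.
Proof.
move=> pn; have n0 : (0 < n)%N.
  by rewrite lt0n; apply: contraTneq pn => ->; rewrite /coprime gcdn0;
    case: p pl_prime => [|[]].
rewrite pabs_nat // (_ : logn p n = 0)%N ?expr0 ?invr1 //.
by apply/eqP; rewrite -leqn0 leqNgt logn_gt0 mem_primes pl_prime n0 -prime_coprime ?pl_prime ?pn.
Qed.

Lemma pabsX x n : x \in nfpred K -> absv (x ^+ n) = absv x ^+ n.
Proof.
move=> xK; elim: n => [|n IH]; first by rewrite !expr0 pabs1.
by rewrite !exprS pabsM ?rpredX // IH.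
Qed.

Lemma pabsV x : x \in nfpred K -> absv x^-1 = (absv x)^-1.
Proof.
move=> xK; have [->|x0] := eqVneq x 0; first by rewrite invr0 pabs0 invr0.
apply: (@mulfI _ (absv x)); first by rewrite pabs_eq0.
by rewrite -pabsM ?rpredV // !divff ?pabs1 // pabs_eq0.
Qed.

Lemma pabsXz x (z : int) : x \in nfpred K -> absv (x ^ z) = absv x ^ z.
Proof.
by move=> xK; case: z => n; rewrite ?NegzE -?exprnP -?exprnN ?pabsV ?pabsX ?rpredX.
Qed.

Lemma pabsN x : x \in nfpred K -> absv (- x) = absv x.
Proof.
move=> xK; rewrite -mulN1r pabsM ?rpredN ?rpred1 //.
have /eqP : absv (-1) ^+ 2 = 1 by rewrite -pabsX ?rpredN ?rpred1 // sqrrN expr1n pabs1.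
by rewrite sqrp_eq1 ?pabs_ge0 // => /eqP->; rewrite mul1r.
Qed.

Lemma pabsB x y : x \in nfpred K -> y \in nfpred K -> absv (x - y) <= Num.max (absv x) (absv y).
Proof. by move=> xK yK; rewrite -(pabsN yK) pabsD ?rpredN. Qed.

Lemma pabsD_le x y a : x \in nfpred K -> y \in nfpred K -> absv x <= a -> absv y <= a ->
  absv (x + y) <= a.
Proof. by move=> xK yK xa ya; rewrite (le_trans (pabsD xK yK)) // ge_max xa. Qed.

Lemma pabsD_lt x y a : x \in nfpred K -> y \in nfpred K -> absv x < a -> absv y < a ->
  absv (x + y) < a.
Proof. by move=> xK yK xa ya; rewrite (le_lt_trans (pabsD xK yK)) // gt_max xa. Qed.

Lemma pabsD_dominant x y : x \in nfpred K -> y \in nfpred K -> absv y < absv x -> absv (x + y) = absv x.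
Proof.
move=> xK yK yx; apply/eqP; rewrite eq_le pabsD_le // ?(ltW yx) //=.
have : absv x <= Num.max (absv (x + y)) (absv y).
  by rewrite -{1}(addrK y x) pabsB ?rpredD.
by rewrite le_max => /orP[//|xy]; rewrite leNgt yx in xy.
Qed.

Lemma pabs_sum_lt (I : eqType) (s : seq I) (F : I -> algC) a : 0 < a ->
  (forall i, i \in s -> F i \in nfpred K /\ absv (F i) < a) -> absv (\sum_(i <- s) F i) < a.
Proof.
move=> a0 H; suff : \sum_(i <- s) F i \in nfpred K /\ absv (\sum_(i <- s) F i) < a by case.
elim: s H => [|i s IH] H; first by rewrite big_nil rpred0 pabs0.
have [FK Fa] := H i (mem_head _ _).
have [|SK Sa] := IH; first by move=> j js; apply: H; rewrite inE js orbT.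
by rewrite big_cons rpredD // pabsD_lt.
Qed.

Definition plring : {pred algC} := fun x => (x \in nfpred K) && (absv x <= 1).

Lemma plring_subring : subring_closed plring.
Proof.
split.
- by apply/andP; rewrite rpred1 pabs1.
- move=> x y /andP[xK x1] /andP[yK y1]; apply/andP; rewrite rpredB //; split=> //.
  by rewrite pabsD_le ?rpredN ?pabsN.
- move=> x y /andP[xK x1] /andP[yK y1]; apply/andP; rewrite rpredM //; split=> //.
  by rewrite pabsM // mulr_ile1 ?pabs_ge0.
Qed.
HB.instance Definition _ := GRing.isSubringClosed.Build algC plring plring_subring.

Lemma plring_total x : x \in nfpred K -> x \in plring \/ x^-1 \in plring.
Proof.
move=> xK; case: (leP (absv x) 1) => [x1|x1]; [left|right]; apply/andP => //.
by rewrite rpredV pabsV // invf_le1 ?(ltW x1) // (lt_trans ltr01).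
Qed.

Lemma plring_coprime n : coprime p n -> (n%:R : algC)^-1 \in plring.
Proof.
move=> pn; apply/andP; rewrite rpredV rpred_nat; split=> //.
by rewrite pabsV ?rpred_nat // pabs_coprime // invr1.
Qed.

Lemma pabs_Aint x : x \in nfpred K -> x \in Aint -> absv x <= 1.
Proof. by move=> xK xA; case/andP: (valring_Aint plring_total xK xA). Qed.

Lemma pabs_rational x : x \in nfpred K -> x != 0 ->
  exists d r, (0 < d)%N /\ absv x ^+ d = p%:R ^ (- r).
Proof.
move=> xK x0.
have [d [r [d0 u]]] := valring_rational plring_total pl_prime plring_coprime xK x0.
have yK : x ^+ d * p%:R ^ (- r) \in nfpred K by rewrite rpredM ?rpredX ?rpredXz ?rpred_nat.
have : absv (x ^+ d * p%:R ^ (- r)) = 1.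
  case/and3P: u => u0 /andP[_ u1] /andP[_].
  rewrite pabsV // invf_le1 ?pabs_gt0 // => u2.
  by apply/eqP; rewrite eq_le u1.
rewrite pabsM ?rpredX ?rpredXz ?rpred_nat // pabsXz ?rpred_nat // pabs_p pabsX // => E.
exists d, r; split=> //.
have pr0 : (p%:R : RR)^-1 ^ (- r) != 0 by rewrite expfz_neq0 // invr_neq0 // gt_eqF ?pl_gt0.
by apply: (mulIf pr0); rewrite E exprz_inv opprK -expfzDr ?addNr // gt_eqF ?pl_gt0.
Qed.

(** The additive valuation with v(p) = 1. It takes the default value 0 at 0 and outside K, where the
    absolute value is 0 and hence no exponential. *)
Definition plval (x : algC) : rat :=
  xget 0 [set q : rat | absv x = expR (- (ln p%:R * ratr q))].

Lemma pabs_val x : x \in nfpred K -> x != 0 -> absv x = expR (- (ln p%:R * ratr (plval x))).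
Proof.
move=> xK x0; apply: (xgetPex 0 (P := [set q : rat | absv x = expR (- (ln p%:R * ratr q))])).
have [d [r [d0 E]]] := pabs_rational xK x0; exists (r%:~R / d%:R).
have Nx0 : 0 < absv x by rewrite pabs_gt0.
rewrite /= -[LHS]lnK //; congr expR.
have d0' : (d%:R : RR) != 0 by rewrite pnatr_eq0 -lt0n.
apply: (mulIf d0'); rewrite fmorph_div /= ratr_int ratr_nat mulNr -mulrA divfK //.
by rewrite mulr_natr -lnXn // E -expR_lnMz ?pl_gt0 // expRK mulrNz mulrN.
Qed.

Lemma plval_unique x q : absv x = expR (- (ln p%:R * ratr q)) -> plval x = q.
Proof.
move=> E; apply: xget_unique => // q' /=; rewrite E => /expR_inj/oppr_inj.
by move/(mulfI (lt0r_neq0 ln_pl_gt0))/fmorph_inj.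
Qed.

Lemma ln_pabs x : x \in nfpred K -> x != 0 -> ln (absv x) = - (ln p%:R * ratr (plval x)).
Proof. by move=> xK x0; rewrite pabs_val // expRK. Qed.

Lemma plvalM x y : x \in nfpred K -> y \in nfpred K -> x != 0 -> y != 0 ->
  plval (x * y) = plval x + plval y.
Proof.
move=> xK yK x0 y0; apply: plval_unique; rewrite pabsM // !pabs_val // -expRD.
by congr expR; rewrite rmorphD mulrDr opprD.
Qed.

Lemma plvalXz x (m : int) : x \in nfpred K -> x != 0 -> plval (x ^ m) = m%:~R * plval x.
Proof.
move=> xK x0; apply: plval_unique; rewrite pabsXz // pabs_val // -expRMz.
by congr expR; rewrite rmorphM /= ratr_int; ring.
Qed.

Lemma plval_eq0 x : x \in nfpred K -> x != 0 -> (plval x == 0) = (absv x == 1).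
Proof.
move=> xK x0; apply/eqP/eqP => [E|E].
  by rewrite pabs_val // E rmorph0 mulr0 oppr0 expR0.
by apply: plval_unique; rewrite E rmorph0 mulr0 oppr0 expR0.
Qed.

End Place.

(** * The place attached to a valuation ring of Qbar *)

Section PlaceOfValuationRing.
Variables (K : numfield) (V : subringClosed algC).
Hypothesis Vtot : forall z, z \in V \/ z^-1 \in V.

(** If all primes were invertible in V, then V would contain Q; being integrally closed, it would
    contain the algebraic number x. *)
Lemma valring_prime x : x \notin V -> exists2 p, prime p & (p%:R : algC)^-1 \notin V.
Proof.
move=> xV; apply: contrapT => nex.
have primeV p : prime p -> (p%:R : algC)^-1 \in V.
  by move=> pp; apply/negPn/negP => pV; apply: nex; exists p.
have natV n : (n%:R : algC)^-1 \in V.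
  elim/ltn_ind: n => n IH.
  have [->|[->|n1]] : n = 0%N \/ (n = 1%N \/ (1 < n)%N).
  - by case: n {IH} => [|[|n]]; [left|right; left|right; right].
  - by rewrite invr0 rpred0.
  - by rewrite invr1 rpred1.
  rewrite -(divnK (pdiv_dvd n)) natrM invfM rpredM //.
    by apply: IH; rewrite ltn_Pdiv ?prime_gt1 ?pdiv_prime // ltnW.
  by apply: primeV; rewrite pdiv_prime.
have ratV (q : rat) : ratr q \in V.
  rewrite /ratr rpredM ?rpred_int // -(gtz0_abs (denq_gt0 q)) -pmulrn.
  exact: natV.
case/negP: xV; have [//|xiV] := Vtot x.
apply: valring_integral (minCpoly_monic x) _ (root_minCpoly x) xiV.
have [f [-> _] _] := minCpolyP x; apply/polyOverP => i.
rewrite coef_map; exact: ratV.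
Qed.

Variables (p : nat) (p_pr : prime p).
Hypothesis pV : (p%:R : algC)^-1 \notin V.

Let p0 : (p%:R : algC) != 0.
Proof. by rewrite pnatr_eq0 -lt0n prime_gt0. Qed.

(** With a p + b n = 1, either p/n is in V and 1/n = a p/n + b, or n/p is in V and so is 1/p = a + b
    n/p, which is excluded. *)
Lemma valring_coprime n : coprime p n -> (n%:R : algC)^-1 \in V.
Proof.
move=> pn.
have n0 : (n%:R : algC) != 0.
  rewrite pnatr_eq0; apply: contraTneq pn => ->; rewrite /coprime gcdn0.
  by case: (p) p_pr => [|[]].
have /coprimezP[[a b] /= ab] : coprimez p n by rewrite /coprimez /gcdz /= eqz_nat.
have {}ab : a%:~R * p%:R + b%:~R * n%:R = 1 :> algC.
  by have := congr1 (fun z : int => z%:~R : algC) ab; rewrite rmorphD !rmorphM /= -!pmulrn.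
have [|] := Vtot (p%:R / n%:R).
  move=> pnV; have -> : n%:R^-1 = a%:~R * (p%:R / n%:R) + b%:~R :> algC.
    by apply: (mulIf n0); rewrite mulVf // mulrDl -mulrA divfK.
  by rewrite rpredD 1?rpredM ?rpred_int.
rewrite invf_div => npV; case/negP: pV.
have -> : p%:R^-1 = a%:~R + b%:~R * (n%:R / p%:R) :> algC.
  by apply: (mulIf p0); rewrite mulVf // mulrDl -mulrA divfK.
by rewrite rpredD 1?rpredM ?rpred_int.
Qed.

Lemma valring_pXz (r : int) : ((p%:R : algC) ^ r \in V) = (0 <= r).
Proof.
case: r => n; first by rewrite -exprnP rpredX ?rpred_nat.
rewrite NegzE; apply/negbTE; apply: contra pV => h.
suff -> : p%:R^-1 = p%:R ^ (- n.+1%:Z) * p%:R ^+ n :> algC by rewrite rpredM ?rpredX ?rpred_nat.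
by rewrite -exprnN exprS invfM -mulrA mulVf ?mulr1 // expf_neq0.
Qed.

(** The value r/d is read off from z^d being p^r times a unit. It is a relation because the pair (d,
    r) is not unique; for z <> 0 the quotient is. *)
Definition vr_val (z : algC) (q : rat) := exists d r,
  [/\ (0 < d)%N, vunit V (z ^+ d * p%:R ^ (- r)) & q = r%:~R / d%:R].

Lemma vr_val_exists z : z \in nfpred K -> z != 0 -> exists q, vr_val z q.
Proof.
move=> zK z0.
have [d [r [d0 u]]] := valring_rational (fun z _ => Vtot z) p_pr valring_coprime zK z0.
by exists (r%:~R / d%:R), d, r.
Qed.

Lemma vr_valM z z' q q' : vr_val z q -> vr_val z' q' -> vr_val (z * z') (q + q').
Proof.
case=> d [r [d0 u ->]] [d' [r' [d'0 u' ->]]].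
exists (d * d')%N, (r * d'%:Z + r' * d%:Z); split; first by rewrite muln_gt0 d0.
  have -> : (z * z') ^+ (d * d') * p%:R ^ (- (r * d'%:Z + r' * d%:Z)) =
      (z ^+ d * p%:R ^ (- r)) ^+ d' * (z' ^+ d' * p%:R ^ (- r')) ^+ d :> algC.
    rewrite !exprMn -!exprM (mulnC d' d) opprD -!mulNr expfzDr // -!exprz_exp.
    by rewrite -!exprnP mulrACA.
  by rewrite vunitM ?vunitX.
have D : (d%:R : rat) != 0 by rewrite pnatr_eq0 -lt0n.
have D' : (d'%:R : rat) != 0 by rewrite pnatr_eq0 -lt0n.
by rewrite natrM rmorphD !rmorphM /= -!pmulrn; field; rewrite D D'.
Qed.

Lemma vr_val_ge0 z q : vr_val z q -> (z \in V) = (0 <= q).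
Proof.
case=> d [r [d0 u ->]].
have D : 0 < (d%:R : rat) by rewrite ltr0n.
rewrite pmulr_lge0 ?invr_gt0 // ler0z -valring_pXz.
have zd : z ^+ d \in V <-> (p%:R : algC) ^ r \in V.
  case/and3P: u => u0 uV uiV; rewrite invfM invr_expz opprK in uiV.
  have z0 : z ^+ d != 0 by apply: contraNneq u0 => ->; rewrite mul0r.
  split=> h; last first.
    suff -> : z ^+ d = (z ^+ d * p%:R ^ (- r)) * p%:R ^ r by rewrite rpredM.
    by rewrite -mulrA -expfzDr // addNr expr0z mulr1.
  by rewrite -[_ ^ r](mulVKf z0) rpredM.
apply/idP/idP => [zV|/zd zV]; first by apply/zd; exact: rpredX.
have [//|ziV] := Vtot z.
suff -> : z = z ^+ d * z^-1 ^+ d.-1 by rewrite rpredM // rpredX.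
have [->|z0] := eqVneq z 0; first by rewrite expr0n (gtn_eqF d0) mul0r.
by rewrite -{1}(prednK d0) exprS -mulrA -exprMn divff // expr1n mulr1.
Qed.

Lemma vr_valV z q : vr_val z q -> vr_val z^-1 (- q).
Proof.
case=> d [r [d0 u ->]]; exists d, (- r); split=> //.
  suff -> : z^-1 ^+ d * p%:R ^ (- - r) = (z ^+ d * p%:R ^ (- r))^-1 :> algC by rewrite vunitV.
  by rewrite invfM exprVn invr_expz.
by rewrite rmorphN mulNr.
Qed.

Lemma vr_val_unique z q q' : z != 0 -> vr_val z q -> vr_val z q' -> q = q'.
Proof.
move=> z0 h h'; have le0 a b : vr_val z a -> vr_val z b -> 0 <= a - b.
  move=> ha hb; have := vr_val_ge0 (vr_valM ha (vr_valV hb)).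
  by rewrite divff // rpred1.
apply/eqP; rewrite eq_le -(subr_ge0 q) -(subr_ge0 q').
by rewrite !le0.
Qed.

Lemma vr_val_rat (q : rat) : q != 0 -> vr_val (ratr q) (vp p q)%:~R.
Proof.
move=> q0; exists 1%N, (vp p q); split; rewrite ?expr1 ?divr1 //.
exact: (vunit_rat p_pr valring_coprime q0).
Qed.

Definition vr_abs (z : algC) : RR :=
  if (z \in nfpred K) && (z != 0) then expR (- (ln p%:R * ratr (xget 0 (vr_val z)))) else 0.

Lemma vr_absE z q : z \in nfpred K -> z != 0 -> vr_val z q ->
  vr_abs z = expR (- (ln p%:R * ratr q)).
Proof.
move=> zK z0 h; rewrite /vr_abs zK z0 /=; congr expR; congr (- (_ * ratr _)).
by apply: xget_unique => // q' h'; exact: vr_val_unique z0 h' h.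
Qed.

Lemma vr_abs_le1 z : z \in nfpred K -> (vr_abs z <= 1) = (z \in V).
Proof.
move=> zK; have [->|z0] := eqVneq z 0.
  by rewrite /vr_abs eqxx andbF ler01 rpred0.
have [q hq] := vr_val_exists zK z0.
rewrite (vr_absE zK z0 hq) (vr_val_ge0 hq) -[X in _ <= X]expR0 ler_expR oppr_le0.
by rewrite pmulr_rge0 ?ln_gt0 ?ltr1n ?prime_gt1 // ler0q.
Qed.

Lemma vr_absM x y : x \in nfpred K -> y \in nfpred K -> vr_abs (x * y) = vr_abs x * vr_abs y.
Proof.
move=> xK yK.
have [->|x0] := eqVneq x 0; first by rewrite mul0r /vr_abs eqxx !andbF mul0r.
have [->|y0] := eqVneq y 0; first by rewrite mulr0 /vr_abs eqxx !andbF mulr0.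
have [a ha] := vr_val_exists xK x0; have [b hb] := vr_val_exists yK y0.
rewrite (vr_absE xK x0 ha) (vr_absE yK y0 hb) -expRD.
rewrite (vr_absE _ _ (vr_valM ha hb)) ?rpredM ?mulf_neq0 //.
by congr expR; rewrite rmorphD mulrDr opprD.
Qed.

Lemma vr_abs_ge0 x : 0 <= vr_abs x.
Proof. by rewrite /vr_abs; case: ifP => // _; rewrite ltW ?expR_gt0. Qed.

Lemma vr_is_place : is_place (nfset K) p vr_abs.
Proof.
split.
- by split=> // x /nfP xK; rewrite /vr_abs (negbTE xK).
- move=> x /nfP xK; split; first exact: vr_abs_ge0.
  rewrite /vr_abs xK /=; split=> [|->]; last by rewrite eqxx.
  by case: eqP => //= _ /eqP; rewrite gt_eqF ?expR_gt0.
- by move=> x y /nfP xK /nfP yK; exact: vr_absM.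
- move=> x y /nfP xK /nfP yK.
  wlog yx : x y xK yK / y = 0 \/ (x != 0 /\ y / x \in V).
    have [->|y0] := eqVneq y 0; first by apply; rewrite ?rpred0 //; left.
    have [->|x0] := eqVneq x 0; first by rewrite addrC maxC; apply; rewrite ?rpred0 //; left.
    move=> IH; have [h|] := Vtot (y / x); first by apply: IH => //; right.
    by rewrite invf_div addrC maxC => h; apply: IH => //; right.
  case: yx => [->|[x0 yxV]]; first by rewrite addr0 le_max lexx.
  have -> : x + y = x * (1 + y / x) by field.
  rewrite vr_absM ?rpredD ?rpred1 ?rpred_div // le_max ler_piMr ?vr_abs_ge0 //.
  by rewrite vr_abs_le1 ?rpredD ?rpred1 ?rpred_div.
- move=> q; rewrite /padic_abs; have [->|q0] := eqVneq q 0.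
    by rewrite rmorph0 /vr_abs eqxx andbF.
  rewrite (vr_absE _ _ (vr_val_rat q0)) ?rpred_rat ?fmorph_eq0 //.
  rewrite ratr_int -mulrN -mulrNz expR_lnMz // ltr0n prime_gt0 //.
Qed.

End PlaceOfValuationRing.

Lemma places_Aint (K : numfield) x : x \in nfpred K ->
  (forall v : place K, pl_abs v x <= 1) -> x \in Aint.
Proof.
move=> xK H; apply: contraT => xA.
have [V [xV yV Vtot]] := exists_valring xA.
have [p p_pr pV] := valring_prime Vtot xV.
pose v : place K := exist _ (p, vr_abs K V p) (vr_is_place K Vtot p_pr pV).
by have := H v; rewrite [pl_abs v x](_ : _ = vr_abs K V p x) // vr_abs_le1 // (negbTE xV).
Qed.

(** The absolute value determines the prime p below v: |p|_v = 1/p, whereas |p|_w = 1 if another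
    prime lies below w. Outside K both functions are 0 by convention. *)
Lemma place_ext (K : numfield) (v w : place K) :
  (forall x, x \in nfpred K -> pl_abs v x = pl_abs w x) -> v = w.
Proof.
move=> H.
have Ep : pl_p v = pl_p w.
  apply/eqP; apply: contraT => np.
  have := H (pl_p v)%:R (rpred_nat _ _); rewrite pabs_p pabs_coprime.
    by move/eqP; rewrite invr_eq1 gt_eqF ?pl_gt1.
  by rewrite prime_coprime ?pl_prime // dvdn_prime2 ?pl_prime // eq_sym.
case: v w H Ep => [[p a] Ha] [[p' a'] Ha'] H /= Ep.
have Ea : a = a'.
  apply: funext => x; case: (pselect (nfset K x)) => xK; first by apply: H; exact/nfP.
  case: (Ha) => -[_ out] _ _ _ _; case: (Ha') => -[_ out'] _ _ _ _.
  exact: etrans (out x xK) (esym (out' x xK)).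
clear H; rewrite /pl_p /= in Ep; subst p' a'.
by congr exist; exact: Prop_irrelevance.
Qed.

(** * Restriction of places to a subfield *)

Section Restriction.
Variables (K L : numfield) (KL : forall x, nfset K x -> nfset L x).

Definition res_abs (w : place L) (x : algC) : RR :=
  if x \in nfpred K then pl_abs w x else 0.

Lemma sub_nfpred x : x \in nfpred K -> x \in nfpred L.
Proof. by move=> /nfP/KL ?; exact/nfP. Qed.

Lemma res_is_place w : is_place (nfset K) (pl_p w) (res_abs w).
Proof.
split.
- by split; [exact: pl_prime|move=> x /nfP xK; rewrite /res_abs (negbTE xK)].
- move=> x /nfP xK; rewrite /res_abs xK pabs_ge0; split=> //.
  by split=> [/eqP|->]; rewrite ?pabs0 // pabs_eq0 ?sub_nfpred // => /eqP.
- by move=> x y /nfP xK /nfP yK; rewrite /res_abs rpredM // xK yK pabsM ?sub_nfpred.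
- by move=> x y /nfP xK /nfP yK; rewrite /res_abs rpredD // xK yK pabsD ?sub_nfpred.
- by move=> q; rewrite /res_abs rpred_rat pabs_rat.
Qed.

Definition res (w : place L) : place K := exist _ (pl_p w, res_abs w) (res_is_place w).

Lemma res_pabs w x : x \in nfpred K -> pl_abs (res w) x = pl_abs w x.
Proof. by move=> xK; rewrite /pl_abs /= /res_abs xK. Qed.

(** Turns the set of places above v into a fibre of [res], so that sums over it can be
    rearranged. *)
Lemma dividesE w v : divides w v <-> v = res w.
Proof.
split=> [H|-> x /nfP xK]; last by rewrite res_pabs.
by apply: place_ext => x xK; rewrite res_pabs // H //; exact/nfP.
Qed.

Lemma res_val w x : x \in nfpred K -> x != 0 -> plval (res w) x = plval w x.
Proof.
move=> xK x0; apply: plval_unique; rewrite res_pabs // pabs_val //; exact: sub_nfpred.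
Qed.

End Restriction.

(** * Weak approximation *)

Lemma exists_denominator (x : algC) : exists2 d : nat, (0 < d)%N & d%:R * x \in Aint.
Proof.
have [f [Df f_monic] _] := minCpolyP x.
have [q [a a0 fq]] := rat_poly_scale f.
suff aA : a%:~R * x \in Aint.
  exists `|a|%N; first by rewrite absz_gt0.
  have [a_ge0|a_lt0] := leP 0 a.
    by rewrite -(gez0_abs a_ge0) -pmulrn in aA.
  rewrite pmulrn (_ : `|a|%N%:~R = - a%:~R :> algC); last by rewrite (ltz0_abs a_lt0) rmorphN.
  by rewrite mulNr rpredN.
have a0' : (a%:~R : rat) != 0 by rewrite intr_eq0.
have ac0 : (a%:~R : algC) != 0 by rewrite intr_eq0.
have f0 := monic_neq0 f_monic.
have szf : (0 < size f)%N by rewrite size_poly_gt0.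
pose n := (size f).-1.
(* This is a^n f(X/a), where a clears the denominators of f: monic, with integer coefficients and
   root a x. *)
pose g : {poly algC} := \poly_(i < n.+1) (ratr f`_i * a%:~R ^+ (n - i)).
have gn : g`_n = 1.
  by rewrite coef_poly ltnSn subnn expr0 mulr1 -lead_coefE (eqP f_monic) rmorph1.
have szg : size g = n.+1.
  by rewrite size_poly_eq // subnn expr0 mulr1 -lead_coefE (eqP f_monic) rmorph1 oner_eq0.
apply: (@root_monic_Aint g).
- apply/rootP; rewrite horner_poly.
  transitivity (a%:~R ^+ n * (minCpoly x).[x]); last first.
    by rewrite (rootP (root_minCpoly x)) mulr0.
  rewrite Df horner_coef size_map_poly mulr_sumr -(prednK szf); apply: eq_bigr => i _.
  have -> : a%:~R ^+ n = a%:~R ^+ (n - i) * a%:~R ^+ i :> algC by rewrite -exprD subnK // -ltnS.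
  by rewrite coef_map exprMn /=; ring.
- by rewrite monicE lead_coefE szg gn.
- apply/polyOverP => i; rewrite coef_poly; case: ifP => [|_]; last exact: rpred0.
  rewrite ltnS leq_eqVlt => /predU1P[->|ltin].
    by rewrite subnn -lead_coefE (eqP f_monic) rmorph1 mul1r expr0 rpred1.
  rewrite -(subSS i n) subSn // exprS mulrA rpredM ?rpredX ?rpred_int //.
  by rewrite fq coefZ coef_map mulrC rmorphM fmorphV /= !ratr_int mulrA divff // mul1r rpred_int.
Qed.

(** The more familiar 1 + z^n can have absolute value < 1 at a place for infinitely many n, whenever
    z^n returns close to -1. Under t -> t (1 + t) a term close to -1 is followed only by terms close
    to 0. *)
Definition sylv (z : algC) k := iter k (fun t => t * (1 + t)) z.

Lemma sylvS z k : sylv z k.+1 = sylv z k * (1 + sylv z k).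
Proof. by []. Qed.

Section Approximation.
Variable K : numfield.

Lemma sylv_nf z k : z \in nfpred K -> sylv z k \in nfpred K.
Proof. by move=> zK; elim: k => // k IH; rewrite sylvS rpredM // rpredD ?rpred1. Qed.

Lemma sylv_le1 (u : place K) z k : z \in nfpred K -> pl_abs u z <= 1 ->
  pl_abs u (sylv z k) <= 1.
Proof.
move=> zK z1; elim: k => // k IH; have sK := sylv_nf k zK; rewrite sylvS.
rewrite pabsM ?rpredD ?rpred1 // mulr_ile1 ?pabs_ge0 //.
by rewrite pabsD_le ?rpred1 ?pabs1.
Qed.

Lemma sylv_gt1 (u : place K) z k : z \in nfpred K -> 1 < pl_abs u z ->
  1 < pl_abs u (1 + sylv z k).
Proof.
move=> zK z1.
have dom t : t \in nfpred K -> 1 < pl_abs u t -> pl_abs u (1 + t) = pl_abs u t.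
  by move=> tK t1; rewrite addrC pabsD_dominant ?rpred1 ?pabs1.
suff s1 : 1 < pl_abs u (sylv z k) by rewrite dom // sylv_nf.
elim: k => // k IH; have sK := sylv_nf k zK; rewrite sylvS.
by rewrite pabsM ?rpredD ?rpred1 // dom // mulr_egt1.
Qed.

(* A place u with |z|_u <= 1 has |1 + sylv z k|_u < 1 for at most one k, since all
   later terms of the sequence are then congruent to 0. *)
Lemma sylv_eventually (u : place K) z : z \in nfpred K ->
  exists N, forall k, (N <= k)%N -> 1 <= pl_abs u (1 + sylv z k).
Proof.
move=> zK; have [z1|z1] := leP (pl_abs u z) 1; last first.
  by exists 0%N => k _; exact: ltW (sylv_gt1 k zK z1).
have [[k lt1]|nex] := pselect (exists k, pl_abs u (1 + sylv z k) < 1); last first.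
  by exists 0%N => k _; rewrite leNgt; apply/negP => lt1; apply: nex; exists k.
have sK j := sylv_nf j zK.
have small j : pl_abs u (sylv z (k.+1 + j)) < 1.
  elim: j => [|j IH].
    rewrite addn0 sylvS pabsM ?rpredD ?rpred1 //.
    by rewrite (le_lt_trans _ lt1) // ler_piMl ?pabs_ge0 ?sylv_le1.
  rewrite addnS sylvS pabsM ?rpredD ?rpred1 //.
  rewrite (le_lt_trans _ IH) // ler_piMr ?pabs_ge0 //.
  by rewrite pabsD_le ?rpred1 ?pabs1 ?sylv_le1.
exists k.+1 => j kj; rewrite pabsD_dominant ?rpred1 ?pabs1 // -(subnKC kj).
exact: small.
Qed.

(** Distinct places differ at some z, and after inversion |z|_v < |z|_w. As values are rational, a
    power of z times a power of p has absolute value 1 at v; since v and w agree on p, it exceeds 1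
    at w. *)
Lemma two_places (v w : place K) : v != w -> pl_p v = pl_p w ->
  exists z, [/\ z \in nfpred K, pl_abs v z <= 1 & 1 < pl_abs w z].
Proof.
move=> vw Ep.
have [z [zK z0 zvw]] : exists z, [/\ z \in nfpred K, z != 0 & pl_abs v z < pl_abs w z].
  have [z zK zne] : exists2 z, z \in nfpred K & pl_abs v z != pl_abs w z.
    apply: contrapT => nex; case/eqP: vw; apply: place_ext => x xK.
    by apply/eqP/negPn/negP => ne; apply: nex; exists x.
  have z0 : z != 0 by apply: contraNneq zne => ->; rewrite !pabs0.
  case: (ltgtP (pl_abs v z) (pl_abs w z)) zne => // lt _; first by exists z.
  exists z^-1; rewrite rpredV invr_eq0; split=> //.
  by rewrite !pabsV // ltf_pV2 // posrE pabs_gt0.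
have [d [r [d0 E]]] := pabs_rational v zK z0.
have p0 := pl_gt0 v.
have pK : (pl_p v)%:R ^ (- r) \in nfpred K by rewrite rpredXz ?rpred_nat.
exists (z ^+ d * (pl_p v)%:R ^ (- r)); rewrite rpredM ?rpredX //.
have Ev : pl_abs v (z ^+ d * (pl_p v)%:R ^ (- r)) = 1.
  rewrite pabsM ?rpredX // pabsX // pabsXz ?rpred_nat // pabs_p E exprz_inv opprK.
  by rewrite -expfzDr ?addNr // gt_eqF.
split=> //; first by rewrite Ev.
rewrite -{1}Ev !pabsM ?rpredX // !pabsX // !pabsXz ?rpred_nat //.
have -> : pl_abs w (pl_p v)%:R = (pl_p v)%:R^-1 by rewrite Ep pabs_p.
rewrite pabs_p ltr_pM2r ?exprz_gt0 ?invr_gt0 //.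
by rewrite ltrXn2r ?pabs_ge0 // -lt0n d0.
Qed.

Lemma approx2 (s : seq (place K)) (v w : place K) : v != w -> pl_p v = pl_p w ->
  exists x, [/\ x \in nfpred K, pl_abs v x = 1, pl_abs w x < 1 &
    forall u, u \in s -> pl_abs u x <= 1].
Proof.
move=> vw Ep; have [z [zK zv zw]] := two_places vw Ep.
have [N HN] : exists N, forall k u, (N <= k)%N -> u \in v :: s -> 1 <= pl_abs u (1 + sylv z k).
  elim: (v :: s) => [|u s' [N HN]]; first by exists 0%N.
  have [M HM] := sylv_eventually u zK; exists (maxn M N) => k t.
  by rewrite geq_max inE => /andP[Mk Nk] /predU1P[->|/HN]; [exact: HM|exact].
have yK : 1 + sylv z N \in nfpred K by rewrite rpredD ?rpred1 ?sylv_nf.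
(* The denominator exceeds 1 in absolute value at w; for this late term it is also at least 1 at v
   and at all places of [s]. *)
exists (1 + sylv z N)^-1; rewrite rpredV pabsV //; split=> //.
- apply/eqP; rewrite invr_eq1 eq_le HN ?mem_head // andbT.
  by rewrite pabsD_le ?rpred1 ?pabs1 ?sylv_nf ?sylv_le1.
- by rewrite pabsV // invf_lt1 ?sylv_gt1 // (lt_trans ltr01) ?sylv_gt1.
- move=> u us; have u1 : 1 <= pl_abs u (1 + sylv z N) by rewrite HN // inE us orbT.
  by rewrite pabsV // invf_le1 // (lt_le_trans ltr01).
Qed.

Lemma approx (s : seq (place K)) (v : place K) :
  (forall u, u \in s -> pl_p u = pl_p v) ->
  exists x, [/\ x \in nfpred K, pl_abs v x = 1 &
    forall u, u \in s -> u != v -> pl_abs u x < 1].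
Proof.
move=> sp.
(* The bound by 1 on all of [s] is carried along so that a new factor does not spoil the places
   already treated. *)
suff H (t : seq (place K)) : {subset t <= s} -> exists x, [/\ x \in nfpred K, pl_abs v x = 1,
    forall u, u \in s -> pl_abs u x <= 1 & forall u, u \in t -> u != v -> pl_abs u x < 1].
  by have [x [xK xv _ xs]] := H s (fun _ h => h); exists x.
elim: t => [|w t IH] ts.
  by exists 1; rewrite rpred1 pabs1; split=> // u _; rewrite pabs1.
have [|x [xK xv x1 xt]] := IH; first by move=> u ut; apply: ts; rewrite inE ut orbT.
have [->|wv] := eqVneq w v.
  exists x; split=> // u; rewrite inE => /predU1P[->|]; last exact: xt.
  by rewrite eqxx.
have ws : w \in s by apply: ts; exact: mem_head.
have vw : v != w by rewrite eq_sym.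
have [y [yK yv yw ys]] := approx2 s vw (esym (sp w ws)).
exists (x * y); split; rewrite ?rpredM //.
- by rewrite pabsM // xv yv mulr1.
- by move=> u us; rewrite pabsM // mulr_ile1 ?pabs_ge0 ?x1 ?ys.
- move=> u; rewrite inE => /predU1P[->|ut] uv.
    by rewrite pabsM // (le_lt_trans _ yw) // ler_piMl ?pabs_ge0 ?x1.
  have us : u \in s by apply: ts; rewrite inE ut orbT.
  by rewrite pabsM // (le_lt_trans _ (xt u ut uv)) // ler_piMr ?pabs_ge0 ?ys.
Qed.

Lemma rat_dependent : exists n, forall x : 'I_n.+1 -> algC, (forall i, x i \in nfpred K) ->
  exists2 q : 'I_n.+1 -> rat, (exists i, q i != 0) & \sum_i ratr (q i) * x i = 0.
Proof.
case: (proj2_sig K) => [_ _ _ _ [n [b Hb]]]; exists n => x xK.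
have /choice[a Ha] : forall i, exists a : 'I_n -> rat, x i = \sum_(j < n) ratr (a j) * b j.
  by move=> i; apply: Hb; exact/nfP.
pose A := \matrix_(i < n.+1, j < n) a i j.
have : kermx A != 0.
  by rewrite -mxrank_eq0 mxrank_ker -lt0n subn_gt0 ltnS rank_leq_col.
case/rowV0Pn => u /sub_kermxP uA /rV0Pn[i ui].
exists (u 0); first by exists i.
under eq_bigr do rewrite Ha mulr_sumr.
rewrite exchange_big big1 // => j _ /=.
have := congr1 (fun M : 'rV_n => ratr (M 0 j) : algC) uA.
rewrite !mxE rmorph_sum rmorph0 => E.
rewrite -[RHS](mul0r (b j)) -[in RHS]E mulr_suml; apply: eq_bigr => k _.
by rewrite mxE rmorphM mulrA.
Qed.

(** Too many places above p would give elements x_i with |x_i| = 1 at the i-th place and < 1 at the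
    others. In a rational relation between them with q_i p-adically largest, the i-th term strictly
    dominates at the i-th place, so these elements would be linearly independent over Q. *)
Lemma finite_places_over p : finite_set [set v : place K | pl_p v = p].
Proof.
apply: contrapT => inf.
have [n dep] := rat_dependent.
have [B Bp szB] := infinite_set_fset n.+1 inf.
have [v0 _] : exists v0, v0 \in finmap.enum_fset B.
  by case: (finmap.enum_fset B) szB => // v0 s _; exists v0; exact: mem_head.
pose s := take n.+1 (finmap.enum_fset B); pose V (i : 'I_n.+1) := nth v0 s i.
have szs : size s = n.+1 by rewrite size_takel.
have Vs i : V i \in s by rewrite mem_nth ?szs.
have Vinj : injective V.
  move=> i j /eqP; rewrite nth_uniq ?szs ?take_uniq ?finmap.fset_uniq //.
  by move/eqP/val_inj.
have sp u : u \in s -> pl_p u = p by move/mem_take => uB; apply: Bp.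
have /choice[x Hx] : forall i, exists x, [/\ x \in nfpred K, pl_abs (V i) x = 1 &
    forall j, j != i -> pl_abs (V j) x < 1].
  move=> i; have [|x [xK xi xs]] := @approx s (V i).
    by move=> u us; rewrite !sp.
  by exists x; split=> // j ji; apply: xs => //; rewrite (inj_eq Vinj).
have [|q [i0 qi0] q0] := dep x; first by move=> i; case: (Hx i).
pose Q (i : 'I_n.+1) : RR := padic_abs p (q i).
pose i := [arg max_(i > i0) Q i]%O.
have Qi j : Q j <= Q i by rewrite /i; case: arg_maxP => // k _; apply.
have qK j : ratr (q j) \in nfpred K by exact: rpred_rat.
have QE j k : pl_abs (V j) (ratr (q k)) = Q k by rewrite pabs_rat sp.
have Qpos : 0 < Q i.
  rewrite (lt_le_trans _ (Qi i0)) // -(QE i0) pabs_gt0 ?fmorph_eq0 //.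
have xK j : x j \in nfpred K by case: (Hx j).
have : pl_abs (V i) (\sum_j ratr (q j) * x j) = Q i.
  have Ei : pl_abs (V i) (ratr (q i) * x i) = Q i.
    by rewrite pabsM // QE; case: (Hx i) => _ -> _; rewrite mulr1.
  rewrite (bigD1 i) //= pabsD_dominant //; first exact: rpredM.
    by apply: rpred_sum => j _; exact: rpredM.
  rewrite Ei -big_filter; apply: pabs_sum_lt => // j.
  rewrite mem_filter => /andP[ji _]; rewrite rpredM //; split=> //.
  rewrite pabsM // QE; have [_ _ Hj] := Hx j.
  rewrite (le_lt_trans (_ : _ <= Q i * pl_abs (V i) (x j))) ?ler_wpM2r ?pabs_ge0 //.
  by rewrite gtr_pMr // Hj // eq_sym.
by rewrite q0 pabs0 => /esym/eqP; rewrite gt_eqF.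
Qed.

(** Integers d and e make d k and e/k integral; at a place whose prime does not divide d e, both k
    and 1/k then have absolute value at most 1. *)
Lemma finite_pabs_neq1 k : k \in nfpred K -> k != 0 ->
  finite_set [set v : place K | pl_abs v k != 1].
Proof.
move=> kK k0.
have [d d0 dk] := exists_denominator k; have [e e0 ek] := exists_denominator k^-1.
apply: (@sub_finite_set _ _ (\bigcup_(p in [set` primes (d * e)]) [set v : place K | pl_p v = p])).
  move=> v /= vk; exists (pl_p v) => //=; apply: contraT => npv.
  have cop : coprime (pl_p v) (d * e).
    rewrite prime_coprime ?pl_prime //; apply: contra npv => pd.
    by rewrite mem_primes pl_prime muln_gt0 d0 e0.
  rewrite coprimeMr in cop; case/andP: cop => cd ce.
  case/negP: vk; rewrite eq_le; apply/andP; split.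
    have := pabs_Aint v (_ : d%:R * k \in nfpred K) dk.
    by rewrite pabsM ?rpred_nat // pabs_coprime // mul1r; apply; rewrite rpredM ?rpred_nat.
  have := pabs_Aint v (_ : e%:R * k^-1 \in nfpred K) ek.
  rewrite pabsM ?rpred_nat ?rpredV // pabs_coprime // mul1r pabsV // invf_le1 ?pabs_gt0 //.
  by apply; rewrite rpredM ?rpred_nat ?rpredV.
apply: bigcup_finite; first exact: finite_seq.
by move=> p _; exact: finite_places_over.
Qed.

Lemma exists_separator (v : place K) : exists x, [/\ x \in nfpred K, x \in Aint,
  pl_abs v x < 1 & forall w, pl_p w = pl_p v -> w != v -> pl_abs w x = 1].
Proof.
have /finite_seqP[s Es] := finite_places_over (pl_p v).
have sP (u : place K) : (u \in s) <-> pl_p u = pl_p v.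
  by have := congr1 (fun A : set (place K) => A u) Es; rewrite /= => ->.
have /choice[e He] : forall w, exists e, w \in s -> [/\ e \in nfpred K, pl_abs w e = 1 &
    forall u, u \in s -> u != w -> pl_abs u e < 1].
  move=> w; have [ws|nws] := boolP (w \in s); last by exists 0.
  have [|e He] := @approx s w; last by exists e.
  by move=> u /sP->; rewrite (proj1 (sP w)).
pose t := [seq w <- undup s | w != v].
(* Each [e w] has absolute value 1 at w and < 1 at the other places above p, so y is small at v and
   of absolute value 1 at every other place above p. *)
pose y := \sum_(w <- t) e w.
have tP w : w \in t -> [/\ w \in s, w != v & e w \in nfpred K].
  by rewrite mem_filter mem_undup => /andP[wv ws]; case: (He w ws).
have yK : y \in nfpred K by rewrite /y big_seq rpred_sum // => w /tP[].
have yv : pl_abs v y < 1.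
  apply: pabs_sum_lt => // w /tP[ws wv eK]; split=> //.
  by case: (He w ws) => _ _; apply; rewrite 1?eq_sym //; exact/sP.
have yw (w : place K) : pl_p w = pl_p v -> w != v -> pl_abs w y = 1.
  move=> /sP ws wv; have [eK ew _] := He w ws.
  have wt : w \in t by rewrite mem_filter mem_undup wv.
  rewrite /y (bigD1_seq w) ?filter_uniq ?undup_uniq //=.
  rewrite pabsD_dominant //.
    by rewrite -big_filter big_seq rpred_sum // => u; rewrite mem_filter => /andP[_ /tP[]].
  rewrite -big_filter ew; apply: pabs_sum_lt => // u.
  rewrite mem_filter => /andP[uw /tP[us _ uK]]; split=> //.
  by case: (He u us) => _ _; apply; rewrite 1?eq_sym.
have [d d0 dy] := exists_denominator y.
(* The prime-to-p part m of the denominator leaves the absolute values above p unchanged; at the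
   remaining places p has absolute value 1, so m y is bounded there as d y is. *)
have [m pm Ed] := logn_part_coprime (pl_prime v) d0.
have mK : (m%:R : algC) \in nfpred K by exact: rpred_nat.
have mabs (w : place K) : pl_p w = pl_p v -> pl_abs w (m%:R * y) = pl_abs w y.
  by move=> Ew; rewrite pabsM // pabs_coprime ?mul1r // Ew.
exists (m%:R * y); rewrite rpredM // !mabs //; split=> //; last first.
  by move=> w Ew wv; rewrite mabs // yw.
apply: (@places_Aint K); first by rewrite rpredM.
move=> w; have [Ew|Ew] := eqVneq (pl_p w) (pl_p v).
  by rewrite mabs //; have [->|wv] := eqVneq w v; rewrite ?(ltW yv) ?yw.
have dK : d%:R * y \in nfpred K by rewrite rpredM ?rpred_nat.
have := pabs_Aint w dK dy.
rewrite {1}Ed natrM natrX -mulrA pabsM ?rpredX ?rpredM ?rpred_nat // pabsX ?rpred_nat //.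
rewrite pabs_coprime ?expr1n ?mul1r //.
by rewrite prime_coprime ?pl_prime // dvdn_prime2 ?pl_prime.
Qed.

End Approximation.

(** * Ideal classes of Z[x] *)

Definition ev (x : algC) (f : {poly int}) : algC := (map_poly intr f).[x].

Section IntegralEval.
Variable x : algC.
Local Notation ev := (ev x).

Lemma evD f g : ev (f + g) = ev f + ev g.
Proof. by rewrite /ev rmorphD hornerD. Qed.
Lemma evB f g : ev (f - g) = ev f - ev g.
Proof. by rewrite /ev rmorphB hornerD hornerN. Qed.
Lemma evM f g : ev (f * g) = ev f * ev g.
Proof. by rewrite /ev rmorphM hornerM. Qed.
Lemma evC c : ev c%:P = c%:~R.
Proof. by rewrite /ev map_polyC hornerC. Qed.
Lemma evX : ev 'X = x.
Proof. by rewrite /ev map_polyX hornerX. Qed.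
Lemma ev_Aint f : x \in Aint -> ev f \in Aint.
Proof.
move=> xA; rewrite /ev horner_coef rpred_sum // => i _.
by rewrite rpredM ?rpredX // coef_map Aint_int.
Qed.
End IntegralEval.

Lemma ev_comp x f g : ev x (f \Po g) = ev (ev x g) f.
Proof. by rewrite /ev map_comp_poly horner_comp. Qed.

Lemma int_minpoly x : x \in Aint -> exists P : {poly int},
  [/\ P \is monic, (1 < size P)%N, ev x P = 0 &
      forall f, ev x f = 0 -> (size f < size P)%N -> f = 0].
Proof.
move=> xA; have [P DP] := floorpP xA; exists P.
have szP : size P = size (minCpoly x).
  by rewrite DP size_map_inj_poly //; exact: intr_inj.
have evP : ev x P = 0 by rewrite /ev -DP; apply/rootP; exact: root_minCpoly.
split=> //.
- have := minCpoly_monic x; rewrite DP !monicE lead_coef_map_inj //; last exact: intr_inj.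
  by rewrite -(rmorph1 intr) (inj_eq intr_inj).
- by rewrite szP (root_size_gt1 _ (root_minCpoly x)) // monic_neq0 ?minCpoly_monic.
- move=> f f0 szf; have [p [Dp p_monic] pP] := minCpolyP x.
  have Ef : map_poly ratr (map_poly intr f : {poly rat}) = map_poly intr f :> {poly algC}.
    by rewrite -map_poly_comp; apply: eq_map_poly => c /=; rewrite ratr_int.
  have : p %| map_poly intr f by rewrite -pP Ef; exact/rootP.
  rewrite Dp size_map_poly in szP.
  have [E|nz] := eqVneq (map_poly intr f : {poly rat}) 0.
    by move=> _; apply: (map_inj_poly (@intr_inj rat)); rewrite ?rmorph0.
  move/(dvdp_leq nz); rewrite size_map_inj_poly //; last exact: intr_inj.
  by rewrite leqNgt -szP szf.
Qed.

(** If h = q X + h_0 is the minimal polynomial of y = [ev x b], then y q(y) = -h_0, and h_0 <> 0 by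
    minimality. The sign [s] turns -h_0 into |h_0|. *)
Lemma ev_inverse x b : x \in Aint -> ev x b != 0 ->
  exists bs (d : nat), (0 < d)%N /\ ev x (b * bs) = d%:R.
Proof.
move=> xA b0; set y := ev x b in b0 *.
have [h [h_monic szh hy hmin]] := int_minpoly (ev_Aint b xA).
have [q Dq] : exists q, h - (h`_0)%:P = q * ('X - 0%:P).
  by apply/factor_theorem; rewrite /root hornerD hornerN hornerC horner_coef0 subrr.
rewrite subr0 in Dq.
have Dh : h = q * 'X + (h`_0)%:P by rewrite -Dq subrK.
have qy : - (h`_0)%:~R = ev y q * y.
  by have := congr1 (ev y) Dq; rewrite evB hy evC sub0r evM evX.
have h0 : h`_0 != 0.
  apply/eqP => E; have q0 : q = 0.
    have [//|qn0] := eqVneq q 0; apply: hmin.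
      by apply: (mulIf b0); rewrite -qy E mul0r oppr0.
    suff -> : size h = (size q).+1 by [].
    by rewrite {1}Dh E addr0 size_mulX.
  by move: szh; rewrite Dh q0 mul0r E addr0 size_poly0.
pose s : int := (-1) ^+ (0 < h`_0)%R.
exists (s%:P * (q \Po b)), (absz h`_0); split; first by rewrite absz_gt0.
rewrite !evM evC ev_comp -/y mulrCA [y * _]mulrC -qy.
rewrite pmulrn.
rewrite -rmorphN -rmorphM; congr _%:~R; rewrite /s abszE.
have [hh|hh|hh] := ltgtP 0 h`_0; rewrite ?expr1 ?expr0 ?mulN1r ?mul1r ?opprK.
- by rewrite gtr0_norm.
- by rewrite ltr0_norm.
- by rewrite -hh eqxx in h0.
Qed.

(** The companion matrix of the minimal polynomial represents multiplication by x on Z[x]. By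
    Cayley-Hamilton f(C) depends only on f(x), which makes det f(C) a norm on Z[x]. *)
Lemma int_matrix_model x : x \in Aint -> exists n (P : {poly int}) (C : 'M[int]_n.+1),
  [/\ P \is monic, size P = n.+2, ev x P = 0 &
      forall f, ev x f = 0 -> horner_mx C f = 0].
Proof.
move=> xA; have [P [P_monic szP evP Pmin]] := int_minpoly xA.
have [n sz] : exists n, size P = n.+2 by case: (size P) szP => [|[|n]] // _; exists n.
have [C DC] : exists C : 'M[int]_n.+1, char_poly C = P.
  move: (companionmx P) (companionmxK P_monic).
  by rewrite sz /= => C DC; exists C.
exists n, P, C; split=> // f f0.
have Df := Pdiv.RingMonic.rdivp_eq P_monic f.
have r0 : Pdiv.Ring.rmodp f P = 0.
  apply: Pmin; last by rewrite Pdiv.Ring.ltn_rmodp monic_neq0.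
  by move: f0; rewrite {1}Df evD evM evP mulr0 add0r.
have CP : horner_mx C P = 0 by rewrite -DC Cayley_Hamilton.
by rewrite Df r0 addr0 rmorphM /= CP mulr0.
Qed.

Lemma det_bound n (A : 'M[int]_n) (c : int) : (forall i j, `|A i j| <= c) ->
  `|\det A| <= n`!%:R * c ^+ n.
Proof.
move=> Ac; rewrite /determinant (le_trans (ler_norm_sum _ _ _)) //.
rewrite -perm.card_Sn mulr_natl -sumr_const ler_sum // => s _.
rewrite normrM normrX normrN1 expr1n mul1r normr_prod.
rewrite -[X in _ ^+ X](card_ord n) -prodr_const ler_prod // => i _.
by rewrite normr_ge0 Ac.
Qed.

Lemma floor_box (m d : nat) (u w : int) : (0 < d)%N ->
  ((m%:Z * u) %/ d%:Z)%Z = ((m%:Z * w) %/ d%:Z)%Z -> `|m%:Z * (u - w)| <= d%:Z.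
Proof.
move=> d0; rewrite mulrBr; move: (m%:Z * u) (m%:Z * w) => U W E.
have d0' : d%:Z != 0 by rewrite eqz_nat -lt0n.
rewrite [X in `|X - _|](divz_eq U d%:Z) [X in `|_ - X|](divz_eq W d%:Z) E.
rewrite opprD addrACA subrr add0r ler_norml.
have := ltz_mod U d0'; have := ltz_mod W d0'; rewrite (_ : `|d%:Z| = d%:Z) //.
by have := modz_ge0 U d0'; have := modz_ge0 W d0'; lra.
Qed.

Lemma nat_pigeonhole (T : finType) (f : nat -> T) :
  exists i j, [/\ (i < j)%N, (j <= #|T|)%N & f i = f j].
Proof.
have : ~~ injectiveb (fun i : 'I_#|T|.+1 => f i).
  by apply/negP => /injectiveP/leq_card; rewrite card_ord ltnn.
case/injectivePn => i [j ij E].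
wlog lt : i j ij E / (i < j)%N => [H|]; last first.
  by exists i, j; split=> //; rewrite -ltnS.
case: (ltngtP i j) => [|lt|/val_inj e]; first exact: H.
  by apply: (H j i) => //; rewrite eq_sym.
by rewrite e eqxx in ij.
Qed.

(** * Division with remainder in Z[x] up to a bounded multiplier *)

Section Hurwitz.
Variables (x : algC) (n : nat) (P : {poly int}) (C : 'M[int]_n.+1).
Hypotheses (xA : x \in Aint) (P_monic : P \is monic) (szP : size P = n.+2).
Hypotheses (evP : ev x P = 0) (evC0 : forall f, ev x f = 0 -> horner_mx C f = 0).

Definition pnorm (f : {poly int}) : int := \det (horner_mx C f).

Lemma pnormM f g : pnorm (f * g) = pnorm f * pnorm g.
Proof. by rewrite /pnorm rmorphM det_mulmx. Qed.

Lemma pnormC c : pnorm c%:P = c ^+ n.+1.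
Proof. by rewrite /pnorm horner_mx_C det_scalar. Qed.

Lemma pnorm_ev f g : ev x f = ev x g -> pnorm f = pnorm g.
Proof.
move=> E; congr (\det _); apply/eqP; rewrite -subr_eq0 -rmorphB.
by apply/eqP/evC0; rewrite evB E subrr.
Qed.

Lemma ev_mod f : exists2 r : {poly int}, (size r <= n.+1)%N & ev x f = ev x r.
Proof.
exists (Pdiv.Ring.rmodp f P); first by rewrite -ltnS -szP Pdiv.Ring.ltn_rmodp monic_neq0.
by rewrite {1}(Pdiv.RingMonic.rdivp_eq P_monic f) evD evM evP mulr0 add0r.
Qed.

Lemma pnorm_bound : exists B : nat, forall (r : {poly int}) (d : nat),
  (size r <= n.+1)%N -> (forall i, `|r`_i| <= d%:Z) ->
  `|pnorm r| <= n.+1`!%:R * (B%:Z * d%:Z) ^+ n.+1.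
Proof.
(* A crude bound: every entry of r(C), a combination of the C^i with i <= n and coefficients at most
   d, is at most B d. *)
pose B := (\sum_(i < n.+1) \sum_(j < n.+1) \sum_(k < n.+1) absz ((C ^+ i) j k))%N.
exists B => r d szr rd; apply: det_bound => j k.
have -> : horner_mx C r = \sum_(i < n.+1) r`_i *: C ^+ i.
  have {1}-> : r = \poly_(i < n.+1) r`_i.
    by apply/polyP => i; rewrite coef_poly; case: ltnP => // le; rewrite nth_default // (leq_trans szr).
  rewrite poly_def raddf_sum; apply: eq_bigr => i _ /=.
  by rewrite horner_mxZ rmorphXn /= horner_mx_X.
rewrite summxE (le_trans (ler_norm_sum _ _ _)) //.
rewrite -natz natr_sum mulr_suml ler_sum // => i _; rewrite mxE normrM mulrC ler_pM //.
rewrite -abszE natz lez_nat (bigD1 j) //= (bigD1 k) //= -addnA.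
exact: leq_addr.
Qed.

(** Write a/b = e/d with coordinates on 1, x, ..., x^n and cut the unit cube of fractional parts
    into m^(n+1) boxes. Two multiples t1 a/b and t2 a/b fall into the same box; their difference is
    an element q of Z[x] plus an error with coordinates at most 1/m, whose norm is less than 1. *)
Lemma hurwitz : exists M : nat, forall a b, ev x b != 0 ->
  exists (t : nat) q, [/\ (0 < t)%N, (t <= M)%N &
    `|pnorm ((t%:Z)%:P * a - q * b)| < `|pnorm b|].
Proof.
have [B HB] := pnorm_bound.
(* This m satisfies (n+1)! B^(n+1) < m^(n+1), where the left side comes from [pnorm_bound]; M is the
   number of boxes. *)
pose m := (n.+1`! * B).+1; pose M := (m ^ n.+1)%N; exists M.
have mB : n.+1`!%:R * (B%:Z) ^+ n.+1 < (m%:Z) ^+ n.+1 :> int.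
  rewrite -!natz -!natrX -natrM ltr_nat.
  rewrite (@leq_ltn_trans ((n.+1`! * B) ^ n.+1)) ?ltn_exp2r //.
  by rewrite expnMn leq_mul // -[X in (X <= _)%N]expn1 leq_pexp2l ?fact_gt0.
move=> a b b0; have [bs [d [d0 bbs]]] := ev_inverse xA b0.
have [e sze Ee] := ev_mod (a * bs).
have d0' : d%:Z != 0 by rewrite eqz_nat -lt0n.
pose u (t : nat) (i : nat) : int := ((t%:Z * e`_i) %% d%:Z)%Z.
have box t i : (absz ((m%:Z * u t i) %/ d%:Z)%Z < m)%N.
  have dp : 0 < d%:Z by rewrite ltz_nat.
  have u0 : 0 <= u t i by exact: modz_ge0.
  have ud : u t i < d%:Z by exact: ltz_mod.
  rewrite -ltz_nat gez0_abs; last by rewrite divz_ge0 // mulr_ge0.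
  by rewrite ltz_divLR // ltr_pM2l.
pose phi (t : nat) : {ffun 'I_n.+1 -> 'I_m} := [ffun i : 'I_n.+1 => Ordinal (box t i)].
have [t1 [t2 [lt12 t2M Ephi]]] := nat_pigeonhole phi.
rewrite card_ffun !card_ord -/M in t2M.
pose q := \poly_(i < n.+1) (((t2%:Z * e`_i) %/ d%:Z)%Z - ((t1%:Z * e`_i) %/ d%:Z)%Z).
pose r := \poly_(i < n.+1) (u t2 i - u t1 i).
exists (t2 - t1)%N, q; split; first by rewrite subn_gt0.
  by rewrite (leq_trans (leq_subr _ _)).
have Er : ev x ((((t2 - t1)%N%:Z)%:P * a - q * b) * bs) = ev x r.
  have -> : r = ((t2 - t1)%N%:Z)%:P * e - q * (d%:Z)%:P.
    apply/polyP => i; rewrite coefB coefCM coefMC !coef_poly; case: ltnP => [_|le].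
      have uE t : u t i = t%:Z * e`_i - ((t%:Z * e`_i) %/ d%:Z)%Z * d%:Z.
        by apply/eqP; rewrite eq_sym subr_eq addrC -divz_eq.
      by rewrite !uE -subzn 1?ltnW //; ring.
    by rewrite nth_default ?mulr0 ?mul0r ?subr0 // (leq_trans sze).
  rewrite mulrBl -!mulrA evB evM evC Ee evM bbs evB !evM !evC pmulrn.
  by [].
have Nr : `|pnorm r| < (d%:Z) ^+ n.+1.
  have m0 : 0 < (m%:Z) ^+ n.+1 by rewrite exprn_gt0.
  rewrite -(ltr_pM2l m0) -[X in X * `|_|](ger0_norm (ltW m0)) -normrM -pnormC -pnormM.
  apply: (@le_lt_trans _ _ (n.+1`!%:R * (B%:Z * d%:Z) ^+ n.+1)); last first.
    by rewrite pnormC exprMn mulrA ltr_pM2r // exprn_gt0 // ltz_nat.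
  apply: HB => [|i].
    by rewrite mul_polyC (leq_trans (size_scale_leq _ _)) ?size_poly.
  rewrite coefCM coef_poly; case: ltnP => [lei|_]; last by rewrite mulr0 normr0.
  apply: floor_box => //.
  have := congr1 (fun f : {ffun 'I_n.+1 -> 'I_m} => nat_of_ord (f (Ordinal lei))) Ephi.
  rewrite !ffunE /= => /(congr1 Posz).
  by rewrite !gez0_abs ?divz_ge0 ?mulr_ge0 ?modz_ge0 // => ->.
(* The estimate was made after multiplication by [bs], which turns b into the integer d;
   multiplicativity of the norm allows this factor to be cancelled. *)
have : `|pnorm (((t2 - t1)%N%:Z)%:P * a - q * b)| * `|pnorm bs| < `|pnorm b| * `|pnorm bs|.
  rewrite -!normrM -!pnormM (pnorm_ev Er) (le_lt_trans _ (lt_le_trans Nr _)) //.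
  by rewrite (@pnorm_ev (b * bs) (d%:Z)%:P) ?pnormC ?normrX // bbs evC -pmulrn.
by apply: contraTT; rewrite -!leNgt => h; rewrite ler_wpM2r.
Qed.

End Hurwitz.

(* Hurwitz' proof that an order Z[x] has finitely many ideal classes. *)
Lemma ideal_class_pigeonhole (x : algC) (I : nat -> set algC) : x \in Aint ->
  (forall m y, I m y -> exists f, y = ev x f) ->
  (forall m y z, I m y -> I m z -> I m (y - z)) ->
  (forall m f y, I m y -> I m (ev x f * y)) ->
  (forall m, exists2 y, I m y & y != 0) ->
  exists m m' b b', [/\ (m < m')%N, I m b /\ b != 0, I m' b' /\ b' != 0 &
    forall y, I m y <-> I m' (b' / b * y)].
Proof.
move=> xA Iev IB IM Inz.
have [n [P [C [P_monic szP evP evC0]]]] := int_matrix_model xA.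
have [M HM] := hurwitz xA P_monic szP evP evC0.
have evmod f := ev_mod P_monic szP evP f.
(* Every multiplier t <= M divides M!, so one integer serves all elements of all the ideals. *)
pose N0 := M`!; have N00 : (N0%:R : algC) != 0 by rewrite pnatr_eq0 -lt0n fact_gt0.
have ID m y z : I m y -> I m z -> I m (y + z).
  move=> Iy Iz; have -> : y + z = y - ev x (-1)%:P * z by rewrite evC mulN1r opprK.
  by apply: IB => //; exact: IM.
(* b is taken nonzero of least norm in I m. The remainder t y - q b lies in I m and has smaller
   norm, so it vanishes; hence N0 I_m is contained in b Z[x]. *)
have /choice[b Hb] : forall m, exists b, [/\ I m (ev x b), ev x b != 0 &
    forall y, I m y -> exists z, N0%:R * y = ev x z * ev x b].
  move=> m.
  pose Q (k : nat) := `[< exists b, [/\ I m (ev x b), ev x b != 0 & absz (pnorm C b) = k] >].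
  have exQ : exists k, Q k.
    have [y Iy y0] := Inz m; have [f Ef] := Iev m y Iy.
    by exists (absz (pnorm C f)); apply/asboolP; exists f; rewrite -Ef.
  case: (ex_minnP exQ) => k /asboolP[b [Ib b0 Ek]] kmin; exists b; split=> // y Iy.
  have [a Ea] := Iev m y Iy; have [t [q [t0 tM lt]]] := HM a b b0.
  have tq : t%:R * y = ev x q * ev x b.
    apply/eqP; rewrite -subr_eq0; apply: contraT => nz.
    have Ez : t%:R * y - ev x q * ev x b = ev x ((t%:Z)%:P * a - q * b).
      by rewrite evB !evM evC -pmulrn Ea.
    have Iz : I m (t%:R * y - ev x q * ev x b).
      apply: IB; last exact: IM.
      by rewrite pmulrn -(evC x); exact: IM.
    have : (k <= absz (pnorm C ((t%:Z)%:P * a - q * b)))%N.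
      by apply: kmin; apply/asboolP; eexists; split; last reflexivity; rewrite -Ez.
    by rewrite -lez_nat -Ek !abszE leNgt lt.
  have /dvdnP[c Ec] : (t %| N0)%N by rewrite dvdn_fact // t0.
  exists ((c%:Z)%:P * q).
  by rewrite Ec natrM -mulrA tq evM evC -pmulrn mulrA.
have N0gt : (0 < N0)%N by exact: fact_gt0.
pose pc (c : {ffun 'I_n.+1 -> 'I_N0}) : {poly int} := \sum_(i < n.+1) (c i)%:Z *: 'X^i.
(* The ideal N0 I_m / b_m of Z[x] contains N0 Z[x], because b_m is in I_m, so it is determined by
   its residues modulo N0. There are finitely many sets of residues, and equal ones give I_m' =
   (b_m'/b_m) I_m. *)
pose J m : {set {ffun 'I_n.+1 -> 'I_N0}} :=
  [set c | `[< exists2 y, I m y & N0%:R * y = ev x (pc c) * ev x (b m) >]]%SET.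
have transfer m m' y : J m = J m' -> I m y -> I m' (ev x (b m') / ev x (b m) * y).
  move=> EJ Iy; have [Ib b0 Hm] := Hb m; have [Ib' b0' Hm'] := Hb m'.
  have [z0 Ez0] := Hm y Iy; have [z szz Ez] := evmod z0; rewrite {}Ez in Ez0.
  have cP (i : 'I_n.+1) : (absz (z`_i %% N0%:Z)%Z < N0)%N.
    rewrite -ltz_nat gez0_abs ?modz_ge0 ?eqz_nat -?lt0n //.
    by rewrite (lt_le_trans (ltz_mod _ _)) ?eqz_nat -?lt0n.
  pose c : {ffun 'I_n.+1 -> 'I_N0} := [ffun i => Ordinal (cP i)].
  pose z' := \sum_(i < n.+1) (z`_i %/ N0%:Z)%Z *: 'X^i : {poly int}.
  have zc : z = pc c + (N0%:Z)%:P * z'.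
    rewrite {1}(_ : z = \poly_(i < n.+1) z`_i).
      rewrite poly_def /pc /z' mulr_sumr -big_split; apply: eq_bigr => i _ /=.
      rewrite ffunE /= mul_polyC scalerA -scalerDl; congr (_ *: _).
      rewrite gez0_abs ?modz_ge0 ?eqz_nat -?lt0n //.
      by rewrite {1}(divz_eq z`_i N0%:Z) addrC mulrC.
    apply/polyP => i; rewrite coef_poly; case: ltnP => // le.
    by rewrite nth_default // (leq_trans szz).
  have Ezc : ev x z = ev x (pc c) + N0%:R * ev x z' by rewrite zc evD evM evC -pmulrn.
  have : c \in J m.
    rewrite inE; apply/asboolP; exists (y - ev x z' * ev x (b m)).
      by apply: IB => //; exact: IM.
    by rewrite mulrBr Ez0 Ezc; ring.
  rewrite EJ inE => /asboolP[y' Iy' Ey'].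
  have -> : ev x (b m') / ev x (b m) * y = y' + ev x z' * ev x (b m').
    apply: (mulfI N00); rewrite mulrDr Ey' mulrCA Ez0 Ezc.
    by field.
  by apply: ID => //; exact: IM.
have [m [m' [lt _ EJ]]] := nat_pigeonhole J.
have [Ib b0 _] := Hb m; have [Ib' b0' _] := Hb m'.
exists m, m', (ev x (b m)), (ev x (b m')); split=> // y; split; first exact: transfer.
move/(transfer _ _ _ (esym EJ)); congr (I m _).
by field; rewrite b0 b0'.
Qed.

(* Finiteness of the class number in valuative form: a power of the prime at v is principal. *)
Lemma exists_isolating (K : numfield) (v : place K) : exists a, [/\ a \in nfpred K,
  a != 0, pl_abs v a < 1 & forall w : place K, w != v -> pl_abs w a = 1].
Proof.
have [x [xK xA xv xw]] := exists_separator v.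
have evK f : ev x f \in nfpred K.
  rewrite /ev horner_coef rpred_sum // => i _.
  by rewrite rpredM ?rpredX // coef_map rpred_int.
have evA f : ev x f \in Aint by exact: ev_Aint.
pose p : algC := (pl_p v)%:R; have pK : p \in nfpred K by exact: rpred_nat.
have p0 : p != 0 by rewrite pnatr_eq0 -lt0n prime_gt0 ?pl_prime.
have pv : pl_abs v p < 1 by rewrite pabs_p invf_lt1 ?pl_gt0 ?pl_gt1.
have zE z : z = x \/ z = p -> exists f, z = ev x f.
  case=> ->; first by exists 'X; rewrite evX.
  by exists ((pl_p v)%:Z)%:P; rewrite evC -pmulrn.
(* Whichever of x and p is larger at v; its absolute value there is the rho of the ideals. *)
have [y0 [y0xp y00 y0v y0max]] : exists y0, [/\ y0 = x \/ y0 = p, y0 != 0, pl_abs v y0 < 1 &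
    forall z, z = x \/ z = p -> pl_abs v z <= pl_abs v y0].
  have [xp|px] := leP (pl_abs v x) (pl_abs v p).
    by exists p; split=> // [|z [->|->]] //; right.
  exists x; split=> // [||z [->|->]] //; [by left| |exact: ltW].
  by rewrite -(pabs_gt0 v xK) (le_lt_trans (pabs_ge0 v p)).
pose I m := [set y | (exists f, y = ev x f) /\ pl_abs v y <= pl_abs v y0 ^+ m].
have y0gt : 0 < pl_abs v y0.
  by have [f Ef] := zE _ y0xp; rewrite pabs_gt0 // Ef evK.
have Ipow z m : z = x \/ z = p -> I m (z ^+ m).
  move=> zxp; have [f Ef] := zE z zxp; split.
    by exists (f ^+ m); rewrite /ev rmorphXn horner_exp -/(ev x f) Ef.
  by rewrite pabsX ?Ef ?evK // -Ef lerXn2r ?nnegrE ?pabs_ge0 ?y0max.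
have [||||m [m' [b [b' [lt [Ib b0] [Ib' b0'] Hab]]]]] := @ideal_class_pigeonhole x I xA.
- by move=> m y [].
- move=> m y z [[f ->] yv] [[g ->] zv]; split; first by exists (f - g); rewrite evB.
  by rewrite pabsD_le ?rpredN ?pabsN ?evK.
- move=> m f y [[g ->] yv]; split; first by exists (f * g); rewrite evM.
  rewrite pabsM ?evK // (le_trans _ yv) // ler_piMl ?pabs_ge0 //.
  by rewrite pabs_Aint.
- by move=> m; exists (y0 ^+ m); [exact: Ipow|exact: expf_neq0].
have bK : b \in nfpred K by case: Ib => -[f ->] _.
have bK' : b' \in nfpred K by case: Ib' => -[f ->] _.
have aK : b' / b \in nfpred K by exact: rpred_div.
have a0 : b' / b != 0 by rewrite mulf_neq0 ?invr_eq0.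
have zK z : z = x \/ z = p -> z \in nfpred K by case=> ->.
exists (b' / b); split=> //.
  (* With a = b'/b, the element y0^m attains the bound of I m, so |a|_v rho^m <= rho^m' < rho^m. *)
  have [_] := proj1 (Hab _) (Ipow y0 m y0xp).
  rewrite (pabsM v aK (rpredX m (zK _ y0xp))) (pabsX v m (zK _ y0xp)) => le.
  rewrite -(ltr_pM2r (exprn_gt0 m y0gt)) mul1r (le_lt_trans le) //.
  by rewrite ltr_iXn2l.
move=> w wv.
(* Since z^m is in I m and z^m' is in I m', both a z^m and z^m'/a are integral, which bounds |a|_w
   by 1 from above and from below. *)
have [z zxp z1] : exists2 z, z = x \/ z = p & pl_abs w z = 1.
  have [Ep|np] := eqVneq (pl_p w) (pl_p v); first by exists x; [left|exact: xw].
  exists p; first by right.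
  by apply: pabs_coprime; rewrite prime_coprime ?pl_prime // dvdn_prime2 ?pl_prime.
have Iint k y : I k y -> pl_abs w y <= 1 by case=> -[f ->] _; exact: pabs_Aint.
apply/eqP; rewrite eq_le; apply/andP; split.
  have := Iint _ _ (proj1 (Hab _) (Ipow z m zxp)).
  by rewrite (pabsM w aK (rpredX m (zK _ zxp))) (pabsX w m (zK _ zxp)) z1 expr1n mulr1.
have : I m ((b' / b)^-1 * z ^+ m').
  by apply/Hab; rewrite mulrA divff // mul1r; exact: Ipow.
have aVK : (b' / b)^-1 \in nfpred K by rewrite rpredV.
move/Iint; rewrite (pabsM w aVK (rpredX m' (zK _ zxp))) (pabsX w m' (zK _ zxp)) z1 expr1n mulr1.
by rewrite pabsV // invf_le1 // pabs_gt0.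
Qed.

(** * The pairing of consistent maps with S *)

Lemma numfield_containing (s : seq algC) :
  exists K : numfield, {subset s <= nfpred K}.
Proof.
have [Qs [QsC [s1 Ds _]]] := num_field_exists s.
pose K (x : algC) := exists y, x = QsC y.
have Knf : is_number_field K.
  split.
  - by split; [exists 0; rewrite rmorph0|exists 1; rewrite rmorph1].
  - by move=> _ _ [y ->] [z ->]; exists (y - z); rewrite rmorphB.
  - by move=> _ _ [y ->] [z ->]; exists (y * z); rewrite rmorphM.
  - by move=> _ [y ->]; exists y^-1; rewrite fmorphV.
  - pose b := vbasis {:Qs}.
    exists (\dim {:Qs}), (fun i => QsC b`_i) => _ [y ->].
    exists (fun i => coord b i y).
    rewrite {1}(coord_vbasis (memvf y)) rmorph_sum; apply: eq_bigr => i _.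
    by rewrite rmorphZ_num.
exists (exist _ K Knf) => x xs; apply/nfP; rewrite /nfset /= /K.
by move: xs; rewrite -Ds => /mapP[y _ ->]; exists y.
Qed.

Lemma compositum (K K' : numfield) : exists L : numfield,
  (forall x, nfset K x -> nfset L x) /\ (forall x, nfset K' x -> nfset L x).
Proof.
have [_ _ _ _ [n [b Hb]]] := proj2_sig K; have [_ _ _ _ [n' [b' Hb']]] := proj2_sig K'.
have [L HL] := numfield_containing (codom b ++ codom b'); exists L; split=> x.
  move=> /Hb[a ->]; apply/nfP; rewrite rpred_sum // => i _.
  by rewrite rpredM ?rpred_rat // HL // mem_cat codom_f.
move=> /Hb'[a ->]; apply/nfP; rewrite rpred_sum // => i _.
by rewrite rpredM ?rpred_rat // HL // mem_cat codom_f orbT.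
Qed.

Lemma unitA1 : unitA 1.
Proof. by rewrite /unitA oner_neq0 invr1 Aint1. Qed.

Lemma unitAM a b : unitA a -> unitA b -> unitA (a * b).
Proof.
move=> [a0 [aA aiA]] [b0 [bA biA]].
by rewrite /unitA mulf_neq0 // invfM !rpredM.
Qed.

Lemma unitAV a : unitA a -> unitA a^-1.
Proof. by move=> [a0 [aA aiA]]; rewrite /unitA invr_eq0 invrK. Qed.

Lemma unitAX a n : unitA a -> unitA (a ^+ n).
Proof.
by move=> ua; elim: n => [|n IH]; [exact: unitA1|rewrite exprS; exact: unitAM].
Qed.

Lemma unitA_plval (K : numfield) (v : place K) u : u \in nfpred K -> unitA u -> plval v u = 0.
Proof.
move=> uK [u0 [uA uiA]]; apply/eqP; rewrite plval_eq0 //.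
have := pabs_Aint v (_ : u^-1 \in nfpred K) uiA; rewrite rpredV pabsV // => /(_ uK).
by rewrite invf_le1 ?pabs_gt0 // eq_le pabs_Aint.
Qed.

Lemma plval_unitA (K : numfield) u : u \in nfpred K -> u != 0 ->
  (forall v : place K, plval v u = 0) -> unitA u.
Proof.
move=> uK u0 H.
have u1 (v : place K) : pl_abs v u = 1 by apply/eqP; rewrite -plval_eq0 // H.
split=> //; split; apply: (@places_Aint K); rewrite ?rpredV // => v.
  by rewrite u1.
by rewrite pabsV // u1 invr1.
Qed.

Lemma finite_plval (K : numfield) k : k \in nfpred K -> k != 0 ->
  finite_set [set v : place K | plval v k != 0].
Proof.
move=> kK k0; apply: sub_finite_set (finite_pabs_neq1 kK k0).
by move=> v /=; rewrite plval_eq0.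
Qed.

(** Minus Phi_c on K^x, kept in [rat]: the factor log p_v cancels against log |k|_v. *)
Definition Psi (c : Jmap) (K : numfield) (k : algC) : rat :=
  \sum_(v \in [set: place K]) c K v * plval v k.

Lemma Psi_widen c K k (D : set (place K)) : (forall v, plval v k != 0 -> D v) ->
  Psi c K k = \sum_(v \in D) c K v * plval v k.
Proof.
move=> H; apply/esym/fsbig_widen => // v [_ /= nD].
have [->|/H//] := eqVneq (plval v k) 0; exact: mulr0.
Qed.

Lemma rmorph_fsum (T : choiceType) (D : set T) (F : T -> rat) : finite_set D ->
  (ratr (\sum_(i \in D) F i) : RR) = \sum_(i \in D) (ratr (F i) : RR).
Proof. by move=> fD; rewrite !fsbig_finite // rmorph_sum. Qed.

Lemma Phi_sumE c K n k : k \in nfpred K -> k != 0 ->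
  Phi_sum c K n k = ratr (- (Psi c K k / n%:R)).
Proof.
move=> kK k0; have fD := finite_plval kK k0.
rewrite (@Psi_widen c K k [set v | plval v k != 0]) // mulr_fsuml -mulN1r mulr_fsumr.
rewrite rmorph_fsum //; apply/esym.
rewrite (fsbig_widen _ [set: place K]) //.
  apply: eq_fsbigr => v _.
  rewrite ln_pabs // !(rmorphM, fmorphV, rmorphN, rmorph1) /= !(fmorphV, ratr_nat) /=.
  have l0 := lt0r_neq0 (ln_pl_gt0 v).
  by move: (ln _) ((n%:R : RR)^-1) l0 => l i l0; field.
by move=> v [_ /= /negP]; rewrite negbK => /eqP->; rewrite !(mulr0, mul0r, rmorph0).
Qed.

Lemma PsiM c K a b : a \in nfpred K -> b \in nfpred K -> a != 0 -> b != 0 ->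
  Psi c K (a * b) = Psi c K a + Psi c K b.
Proof.
move=> aK bK a0 b0.
pose D := [set v : place K | plval v a != 0] `|` [set v | plval v b != 0].
have fD : finite_set D by rewrite finite_setU; split; exact: finite_plval.
rewrite (@Psi_widen c K (a * b) D) ?(@Psi_widen c K a D) ?(@Psi_widen c K b D); first last.
- move=> v; rewrite plvalM //; apply: contra_neqP => /not_orP[/= /negP + /negP].
  by rewrite !negbK => /eqP-> /eqP->; rewrite addr0.
- by move=> v va; left.
- by move=> v va; right.
by rewrite -fsbig_split //; apply: eq_fsbigr => v _; rewrite plvalM // mulrDr.
Qed.

Lemma PsiXz c K a (m : int) : a \in nfpred K -> a != 0 -> Psi c K (a ^ m) = m%:~R * Psi c K a.
Proof.
move=> aK a0; rewrite /Psi mulr_fsumr; apply: eq_fsbigr => v _.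
by rewrite plvalXz // mulrCA.
Qed.

Lemma finite_divides (K L : numfield) (KL : forall x, nfset K x -> nfset L x) (v : place K) :
  finite_set [set w : place L | divides w v].
Proof.
apply: sub_finite_set (finite_places_over L (pl_p v)).
by move=> w /= /(dividesE KL)->.
Qed.

(** The places w of L are grouped by their restriction v: within a group k has the same valuation,
    and by consistency the c(L,w) add up to c(K,v). *)
Lemma Psi_extend c (K L : numfield) k : (forall x, nfset K x -> nfset L x) ->
  consistent c -> k \in nfpred K -> k != 0 -> Psi c L k = Psi c K k.
Proof.
move=> KL cc kK k0.
have /finite_seqP[s Es] := finite_plval kK k0.
have sP (v : place K) : (v \in undup s) = (plval v k != 0).
  rewrite mem_undup; apply/idP/idP => vs.
    by have : [set` s] v by []; rewrite -Es.
  by have : [set v : place K | plval v k != 0] v by []; rewrite Es.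
have fD : finite_set [set w : place L | res KL w \in s].
  apply: (@sub_finite_set _ _ (\bigcup_(v in [set` s]) [set w : place L | pl_p w = pl_p v])).
    by move=> w /= ws; exists (res KL w).
  by apply: bigcup_finite => [|v _]; [exact: finite_seq|exact: finite_places_over].
rewrite (@Psi_widen c L k [set w | res KL w \in s]); last first.
  move=> w wk; rewrite /= -mem_undup sP res_val //.
rewrite (@Psi_widen c K k [set` s]); last by move=> v vk; rewrite /= -mem_undup sP.
transitivity (\sum_(w \in [set w | res KL w \in s]) \sum_(v \in [set` s])
    if res KL w == v then c L w * plval v k else 0).
  apply: eq_fsbigr => w; rewrite inE /= => ws.
  rewrite (fsbigD1 (res KL w)) //= eqxx res_val // fsbig1 ?addr0 //.
  by move=> v [_ /= /eqP]; rewrite eq_sym => /negbTE->.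
rewrite exchange_fsbig //=; apply: eq_fsbigr => v; rewrite inE /= => vs.
rewrite (cc K L KL v) mulr_fsuml.
rewrite (_ : [set w : place L | divides w v] =
    [set w | res KL w \in s] `&` [set w | res KL w = v]).
  rewrite fsbig_mkcondr; apply: eq_fsbigr => w _.
  by congr (if _ then _ else _); apply/eqP/idP; rewrite inE.
apply/seteqP; split=> w /=; first by move/(dividesE KL) => E; rewrite -E.
by case=> _ E; apply/(dividesE KL).
Qed.

Lemma SK_rep_neq0 K a n k : SK_rep K a n k -> a != 0.
Proof.
case=> n0 _ k0 [+ _]; apply: contraNneq => ->.
by rewrite expr0n (gtn_eqF n0) mul0r.
Qed.

(** In a compositum k^n' and k'^n both equal a^(n n') up to a unit, so n' w(k) = n w(k') at every
    place w, and the two sums agree term by term. *)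
Lemma Psi_rep_unique c K K' a n n' k k' : consistent c ->
  SK_rep K a n k -> SK_rep K' a n' k' -> Psi c K k / n%:R = Psi c K' k' / n'%:R.
Proof.
move=> cc R1 R2; have a0 := SK_rep_neq0 R1.
case: R1 R2 => n0 /nfP kK k0 u [n'0 /nfP kK' k0' u'].
have [L [KL KL']] := compositum K K'.
have kL := sub_nfpred KL kK; have kL' := sub_nfpred KL' kK'.
rewrite -(Psi_extend KL cc kK k0) -(Psi_extend KL' cc kK' k0') /Psi !mulr_fsuml.
apply: eq_fsbigr => w _; rewrite -!mulrA; congr (_ * _).
have : unitA (k ^ n'%:Z * k' ^ (- n%:Z)).
  have -> : k ^ n'%:Z * k' ^ (- n%:Z) = (a ^+ n' / k') ^+ n * ((a ^+ n / k) ^+ n')^-1.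
    rewrite -exprnN -exprnP !expr_div_n -!exprM (mulnC n' n).
    by field; rewrite !expf_neq0.
  by apply: unitAM; [exact: unitAX|apply: unitAV; exact: unitAX].
move/(unitA_plval w); rewrite plvalM ?plvalXz ?rpredXz ?expfz_neq0 // rpredM ?rpredXz //.
move=> /(_ isT) /eqP; rewrite mulrNz mulNr subr_eq0 -!pmulrn => /eqP E.
have N : (n%:R : rat) != 0 by rewrite pnatr_eq0 -lt0n.
have N' : (n'%:R : rat) != 0 by rewrite pnatr_eq0 -lt0n.
by apply/eqP; rewrite eqr_div // mulrC E mulrC.
Qed.

Lemma PhiE c K a n k : consistent c -> SK_rep K a n k ->
  Phi c a = ratr (- (Psi c K k / n%:R)).
Proof.
move=> cc R; apply: xget_unique.
  by exists K, n, k; split=> //; case: R => _ /nfP kK k0 _; rewrite Phi_sumE.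
move=> _ [K' [n' [k' [R' ->]]]]; rewrite (Psi_rep_unique cc R R').
by case: R' => _ /nfP kK' k0' _; rewrite Phi_sumE.
Qed.

Lemma SK_rep1 (K : numfield) a : a \in nfpred K -> a != 0 -> SK_rep K a 1 a.
Proof. by move=> /nfP aK a0; split=> //; rewrite expr1 divff //; exact: unitA1. Qed.

Lemma Phi1E c (K : numfield) a : consistent c -> a \in nfpred K -> a != 0 ->
  Phi c a = ratr (- Psi c K a).
Proof. by move=> cc aK a0; rewrite (PhiE cc (SK_rep1 aK a0)) divr1. Qed.

Lemma consistentD c1 c2 (r1 r2 : rat) : consistent c1 -> consistent c2 ->
  consistent (fun K v => r1 * c1 K v + r2 * c2 K v).
Proof.
move=> cc1 cc2 K L KL v; rewrite (cc1 K L KL v) (cc2 K L KL v) !mulr_fsumr.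
by rewrite fsbig_split //; exact: finite_divides.
Qed.

Lemma PsiDc c1 c2 (r1 r2 : rat) K k : k \in nfpred K -> k != 0 ->
  Psi (fun K v => r1 * c1 K v + r2 * c2 K v) K k = r1 * Psi c1 K k + r2 * Psi c2 K k.
Proof.
move=> kK k0; have fD := finite_plval kK k0.
rewrite !(@Psi_widen _ K k [set v | plval v k != 0]) // !mulr_fsumr -fsbig_split //.
by apply: eq_fsbigr => v _; rewrite mulrDl !mulrA.
Qed.

Definition isolating (K : numfield) (v : place K) : algC :=
  xget 0 [set a | [/\ a \in nfpred K, a != 0, pl_abs v a < 1 &
    forall w : place K, w != v -> pl_abs w a = 1]].

Lemma isolatingP (K : numfield) (v : place K) : [/\ isolating v \in nfpred K, isolating v != 0,
  plval v (isolating v) != 0 & forall w, w != v -> plval w (isolating v) = 0].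
Proof.
have [aK a0 av aw] := xgetPex 0 (exists_isolating v); rewrite -/(isolating v) in aK a0 av aw.
split=> //; first by rewrite plval_eq0 // lt_eqF.
by move=> w wv; apply/eqP; rewrite plval_eq0 // aw.
Qed.

Lemma Psi_isolating c K (v : place K) : Psi c K (isolating v) = c K v * plval v (isolating v).
Proof.
have [_ _ _ aw] := isolatingP v.
rewrite (@Psi_widen _ _ _ [set v]) ?fsbig_set1 // => w /=.
by apply: contra_neqP => /eqP/aw.
Qed.

(** * Linear forms on S come from consistent maps *)

Section SLinear.
Variables (f : algC -> rat) (fL : S_linear f).

Lemma S_linearXz a (m : int) : a != 0 -> f (a ^ m) = m%:~R * f a.
Proof.
move=> a0; have [_ H] := fL.
rewrite (H a (a ^ m) m 1%N) ?divr1 ?expfz_neq0 //.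
by rewrite expr1 divff ?expfz_neq0 //; exact: unitA1.
Qed.

Lemma S_linear_unit u : unitA u -> f u = 0.
Proof.
move=> uA; have [_ H] := fL; case: (uA) => u0 _.
rewrite (H 1 u 0 1%N) ?oner_neq0 ?mul0r //.
by rewrite expr1 expr0z divr1.
Qed.

(** The isolating elements span the image of K^x over Q: dividing a power of k by a power of a_v
    removes v from the support, and an element with empty support is a unit, where f vanishes. *)
Lemma S_linear_places (K : numfield) (s : seq (place K)) k : uniq s ->
  k \in nfpred K -> k != 0 -> (forall v, v \notin s -> plval v k = 0) ->
  f k = \sum_(v <- s) plval v k / plval v (isolating v) * f (isolating v).
Proof.
elim: s k => [|v s IH] k.
  move=> _ kK k0 H; rewrite big_nil; apply: S_linear_unit.
  by apply: (plval_unitA kK k0) => v; exact: H.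
case/andP=> vs us kK k0 H; have [aK a0 av aw] := isolatingP v.
set a := isolating v in aK a0 av aw *.
pose q := plval v k / plval v a.
(* The quotient q = v(k)/v(a) is only rational, so k is first raised to its denominator; k' has
   valuation 0 at v, and at other places that of k times [denq q]. *)
pose k' := k ^ denq q * a ^ (- numq q).
have dq0 : ((denq q)%:~R : rat) != 0 by rewrite intr_eq0 denq_neq0.
have k'v (w : place K) : plval w k' = (denq q)%:~R * plval w k - (numq q)%:~R * plval w a.
  by rewrite plvalM ?plvalXz ?rpredXz ?expfz_neq0 // mulrNz mulNr.
have := IH k' us.
rewrite rpredM ?rpredXz // mulf_neq0 ?expfz_neq0 // => /(_ isT isT) H'.
have {}H' : f k' = \sum_(w <- s) plval w k' / plval w (isolating w) * f (isolating w).
  apply: H' => w ws; rewrite k'v; have [->|wv] := eqVneq w v.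
    rewrite -[X in _ * X - _](divfK av) -/q -{2}(divq_num_den q) mulrA [_ * (_ / _)]mulrC.
    by rewrite divfK // subrr.
  by rewrite (aw w wv) H ?mulr0 ?subr0 // inE negb_or wv.
have fk' : f k' = (denq q)%:~R * f k - (numq q)%:~R * f a.
  have [HM _] := fL; rewrite HM ?expfz_neq0 // !S_linearXz //.
  by rewrite mulrNz mulNr.
rewrite big_cons -/a -/q; apply: (mulfI dq0); rewrite mulrDr.
have -> : (denq q)%:~R * (q * f a) = (numq q)%:~R * f a.
  by rewrite mulrA [_ * q]mulrC -{1}(divq_num_den q) divfK.
apply/eqP; rewrite addrC -subr_eq -fk' H' mulr_sumr; apply/eqP.
apply: eq_big_seq => w ws; rewrite k'v (aw w) ?mulr0 ?subr0 ?mulrA //.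
by apply: contraNneq vs => <-.
Qed.

Definition cmap : Jmap := fun K v => - (f (isolating v) / plval v (isolating v)).

Lemma Psi_cmap (K : numfield) k : k \in nfpred K -> k != 0 -> Psi cmap K k = - f k.
Proof.
move=> kK k0; have /finite_seqP[s Es] := finite_plval kK k0.
have sP (v : place K) : v \notin undup s -> plval v k = 0.
  rewrite mem_undup => nv; apply/eqP; apply: contraNT nv => vk.
  by have : [set v : place K | plval v k != 0] v by []; rewrite Es.
rewrite (@Psi_widen _ _ _ [set` undup s]); last first.
  by move=> v vk /=; apply: contraT => /sP E; rewrite E eqxx in vk.
rewrite -fsbig_seq ?undup_uniq // (S_linear_places (undup_uniq s) kK k0 sP) -sumrN.
by apply: eq_bigr => v _; rewrite /cmap; ring.
Qed.

(** Apply [Psi_cmap] over L to the isolating element a_v of K: its valuation is v(a_v) at each w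
    above v and 0 elsewhere, and v(a_v) can be divided out. *)
Lemma cmap_consistent : consistent cmap.
Proof.
move=> K L KL v; have [aK a0 av aw] := isolatingP v.
have aL := sub_nfpred KL aK.
have := Psi_cmap aL a0; rewrite (@Psi_widen _ _ _ [set w : place L | divides w v]).
  rewrite (eq_fsbigr (fun w => cmap w * plval v (isolating v))).
    rewrite -mulr_fsuml => E; apply: (mulIf av); rewrite E.
    by rewrite /cmap mulNr divfK.
  by move=> w; rewrite inE /= => /(dividesE KL) E; rewrite -(res_val KL w aK a0) -E.
move=> w; apply: contra_neqP => ndiv; rewrite -(res_val KL) // aw //.
by apply/eqP => E; apply: ndiv; exact/(dividesE KL).
Qed.

End SLinear.

Theorem theorem1p1 :
  (* c |-> Phi_c maps J^* into S^* *)
  (forall c : Jmap, consistent c ->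
     exists f : algC -> rat, S_linear f /\
       forall alpha : algC, alpha != 0 -> Phi c alpha = (ratr (f alpha) : RR))
  /\
  (* it is Q-linear *)
  (forall (c1 c2 : Jmap) (r1 r2 : rat), consistent c1 -> consistent c2 ->
     forall alpha : algC, alpha != 0 ->
       Phi (fun K v => r1 * c1 K v + r2 * c2 K v) alpha
       = ratr r1 * Phi c1 alpha + ratr r2 * Phi c2 alpha)
  /\
  (* injective *)
  (forall c1 c2 : Jmap, consistent c1 -> consistent c2 ->
     (forall alpha : algC, alpha != 0 -> Phi c1 alpha = Phi c2 alpha) ->
     c1 = c2)
  /\
  (* surjective onto S^* *)
  (forall f : algC -> rat, S_linear f ->
     exists c : Jmap, consistent c /\
       forall alpha : algC, alpha != 0 -> Phi c alpha = (ratr (f alpha) : RR)).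
Proof.
split; last split; last split.
- move=> c cc; pose f a : rat := xget 0 [set q | Phi c a = ratr q].
  have fE K a n k : SK_rep K a n k -> f a = - (Psi c K k / n%:R).
    move=> R; apply: xget_unique; first exact: (PhiE cc R).
    by move=> q /=; rewrite (PhiE cc R) => /fmorph_inj.
  exists f; split; last first.
    move=> a a0; have [K aK] := numfield_containing [:: a].
    have R := SK_rep1 (aK a (mem_head _ _)) a0.
    by rewrite (fE _ _ _ _ R) (PhiE cc R).
  split=> [a b a0 b0|a b m n a0 b0 n0 u].
    have [K abK] := numfield_containing [:: a; b].
    have aK : a \in nfpred K by apply: abK; rewrite !inE eqxx.
    have bK : b \in nfpred K by apply: abK; rewrite !inE eqxx orbT.
    rewrite (fE _ _ _ _ (SK_rep1 aK a0)) (fE _ _ _ _ (SK_rep1 bK b0)).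
    rewrite (fE _ _ _ _ (SK_rep1 (rpredM aK bK) (mulf_neq0 a0 b0))) PsiM // !divr1.
    exact: opprD.
  have [K aK] := numfield_containing [:: a]; have {}aK := aK a (mem_head _ _).
  (* As b represents a^(m/n), the pair (n, a^m) computes Phi_c(b) in a field containing only a. *)
  have R : SK_rep K b n (a ^ m).
    by split=> //; [apply/nfP; rewrite rpredXz|rewrite expfz_neq0].
  rewrite (fE _ _ _ _ R) (fE _ _ _ _ (SK_rep1 aK a0)) PsiXz // divr1.
  by rewrite mulrN mulrAC.
- move=> c1 c2 r1 r2 cc1 cc2 a a0.
  have [K aK] := numfield_containing [:: a]; have {}aK := aK a (mem_head _ _).
  rewrite (Phi1E (consistentD r1 r2 cc1 cc2) aK a0) (Phi1E cc1 aK a0) (Phi1E cc2 aK a0).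
  by rewrite PsiDc // -!rmorphM -rmorphD; congr ratr; ring.
- move=> c1 c2 cc1 cc2 H; apply: functional_extensionality_dep => K; apply: funext => v.
  have [aK a0 av _] := isolatingP v.
  have := H _ a0; rewrite (Phi1E cc1 aK a0) (Phi1E cc2 aK a0) => /fmorph_inj/oppr_inj.
  by rewrite !Psi_isolating => /(mulIf av).
- move=> f fL; exists (cmap f); split; first exact: cmap_consistent.
  move=> a a0; have [K aK] := numfield_containing [:: a].
  have {}aK := aK a (mem_head _ _).
  by rewrite (Phi1E (cmap_consistent fL) aK a0) Psi_cmap // opprK.
Qed.
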